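(* Let $n=2k$ be even, with $k\ge 1$ an integer. A function $g\in C^\infty(\mathbb{R}^{2k-1}\times\mathbb{R})$ is in the range of the restricted conical Radon transform $\mathcal{C}$ on $C_0^\infty(\mathbb{R}^{2k-1}\times\mathbb{R})$ (i.e. $g=\mathcal{C}[f]$ for some $f\in C_0^\infty(\mathbb{R}^{2k-1}\times\mathbb{R})$) if and only if the following conditions are satisfied: (i) $\square^k g(\boldsymbol{x},t)$ has compact support. (ii) $\int_{-\infty}^{\infty}\square^k g(\boldsymbol{x},t)\,dt=0$ for every $\boldsymbol{x}\in\mathbb{R}^{2k-1}$. (iii) $\operatorname{supp} g\subseteq H_{t_0}$ for some $t_0\in\mathbb{R}$.
   Context: Points of $\mathbb{R}^n=\mathbb{R}^{n-1}\times\mathbb{R}$ are written $(\boldsymbol{x},t)$. $C_0^\infty$ denotes smooth functions with compact support. For $t_0\in\mathbb{R}$, $H_{t_0}=\{(\boldsymbol{x},t): t\le t_0\}$. The d'Alembertian is $\square=\frac{\partial^2}{\partial t^2}-\Delta_{\boldsymbol{x}}$, where $\Delta_{\boldsymbol{x}}$ is the Laplacian in $\boldsymbol{x}\in\mathbb{R}^{n-1}$, and $\square^k$ is its $k$-th power. The restricted conical Radon transform $\mathcal{C}$ (half-opening angle $\pi/4$, axis direction $\boldsymbol{e}_n=(\boldsymbol{0},1)$) is convolution with the distribution $D(\boldsymbol{x},t)=\delta(-t-|\boldsymbol{x}|)$, $\delta$ the Dirac delta, that is $$\mathcal{C}[f](\boldsymbol{x},t)=(D*f)(\boldsymbol{x},t)=\int_{\mathbb{R}^{n-1}}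 f(\boldsymbol{x}+\boldsymbol{u},\,t+|\boldsymbol{u}|)\,d\boldsymbol{u}.$$ Up to a positive constant factor this is the integral of $f$ with respect to surface measure over the cone with vertex $(\boldsymbol{x},t)$, axis direction $\boldsymbol{e}_n$ and half-opening angle $\pi/4$. *)

(* Defs.v *)
From HB Require Import structures.
From mathcomp Require Import all_boot all_order all_algebra.
From mathcomp Require Import all_classical all_reals all_analysis.

Set Implicit Arguments.
Unset Strict Implicit.
Unset Printing Implicit Defensive.

Import Order.TTheory GRing.Theory Num.Theory.
Import numFieldNormedType.Exports.

Local Open Scope classical_set_scope.
Local Open Scope ring_scope.

(* The library has no Lebesgue measure on R^m; it is built here on m-tuples
   (with their product sigma-algebra) as the m-fold product of the
   one-dimensional Lebesgue measure. *)
Section LebesgueTuple.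
Context {R : realType}.
Local Notation T := (measurableTypeR R).

Definition pair_cons n (p : T * n.-tuple T) : n.+1.-tuple T :=
  [tuple of p.1 :: p.2].

Definition pair_uncons n (q : n.+1.-tuple T) : T * n.-tuple T :=
  (thead q, [tuple of behead q]).

Lemma pair_consK n : cancel (@pair_cons n) (@pair_uncons n).
Proof.
by case=> x t; rewrite /pair_uncons /pair_cons theadE; congr pair; exact/val_inj.
Qed.

Lemma measurable_pair_cons n : measurable_fun [set: T * n.-tuple T] (@pair_cons n).
Proof.
apply: (@measurable_cons _ _ _ _ fst n snd); first exact: measurable_fst.
exact: measurable_snd.
Qed.

Lemma measurable_pair_uncons n :
  measurable_fun [set: n.+1.-tuple T] (@pair_uncons n).
Proof.
apply/measurable_fun_pair; first exact: measurable_tnth.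
exact: measurable_behead.
Qed.

Section Step.
Variables (n : nat) (mu : {sigma_finite_measure set (n.-tuple T) -> \bar R}).

Definition lebesgue_cons : set (n.+1.-tuple T) -> \bar R :=
  pushforward (lebesgue_measure \x mu)%E (@pair_cons n).

Let preimageK (A : set (T * n.-tuple T)%type) :
  @pair_cons n @^-1` (@pair_uncons n @^-1` A) = A.
Proof. by apply/funext => p; rewrite /preimage /= pair_consK. Qed.

Let lebesgue_cons0 : lebesgue_cons set0 = 0%E.
Proof. by rewrite /lebesgue_cons /pushforward preimage_set0 measure0. Qed.

Let lebesgue_cons_ge0 A : (0 <= lebesgue_cons A)%E.
Proof. by rewrite /lebesgue_cons /pushforward measure_ge0. Qed.

Let lebesgue_cons_sigma_additive : semi_sigma_additive lebesgue_cons.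
Proof.
have mpre A : measurable A -> measurable (@pair_cons n @^-1` A).
  by move=> mA; rewrite -[X in measurable X]setTI; exact: measurable_pair_cons.
move=> F mF tF mUF; rewrite /lebesgue_cons /pushforward preimage_bigcup.
apply: measure_semi_sigma_additive.
- by move=> i; exact: mpre.
- apply/trivIsetP => /= i j _ _ ij; rewrite -preimage_setI.
  by move/trivIsetP : tF => /(_ _ _ _ _ ij) ->//; rewrite preimage_set0.
- by rewrite -preimage_bigcup; exact: mpre.
Qed.

HB.instance Definition _ := isMeasure.Build _ _ _ lebesgue_cons
  lebesgue_cons0 lebesgue_cons_ge0 lebesgue_cons_sigma_additive.

Let lebesgue_cons_sigma_finite : sigma_finite setT lebesgue_cons.
Proof.
have /sigma_finiteP[F [FT ndF Foo]] := sigma_finiteT (@lebesgue_measure R).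
have /sigma_finiteP[G [GT ndG Goo]] := sigma_finiteT mu.
exists (fun i => @pair_uncons n @^-1` (F i `*` G i)).
  rewrite -preimage_bigcup -[LHS](preimage_setT (@pair_uncons n)).
  congr preimage; rewrite -setXTT FT GT predeqE => -[x y]; split.
    move=> [/= [i _ Fix] [j _ Gjy]]; exists (maxn i j) => //; split.
      by move: x Fix; exact/subsetPset/ndF/leq_maxl.
    by move: y Gjy; exact/subsetPset/ndG/leq_maxr.
  by move=> [i _ []/= ? ?]; split; exists i.
move=> i; have [mF Fi] := Foo i; have [mG Gi] := Goo i; split.
  rewrite -[X in measurable X]setTI.
  by apply: measurable_pair_uncons => //; exact: measurableX.
rewrite /lebesgue_cons /pushforward preimageK product_measure1E//.
by rewrite lte_mul_pinfty// ge0_fin_numE.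
Qed.

HB.instance Definition _ := @Measure_isSigmaFinite.Build _ _ _ lebesgue_cons
  lebesgue_cons_sigma_finite.

End Step.

Fixpoint lebesgue_tuple (n : nat) :
    {sigma_finite_measure set (n.-tuple T) -> \bar R} :=
  match n with
  | 0 => dirac [tuple]
  | n'.+1 => lebesgue_cons (lebesgue_tuple n')
  end.

Lemma lebesgue_tuple_box n (A : 'I_n -> set T) :
    (forall i, measurable (A i)) ->
  lebesgue_tuple n [set u | forall i, A i (tnth u i)] =
  (\prod_(i < n) lebesgue_measure (A i))%E.
Proof.
elim: n A => [|n IHn] A mA.
  rewrite big_ord0 /= diracE.
  by rewrite (_ : _ \in _ = true)//; apply/mem_set => -[].
rewrite big_ord_recl -IHn//= /lebesgue_cons /pushforward -product_measure1E//.
- congr (product_measure1 _ _ _); apply/seteqP; split=> -[x t] /=.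
    move=> Axt; split; first exact: (Axt ord0).
    move=> i; have := Axt (lift ord0 i); rewrite tnthS.
    by congr (A _ (tnth _ _)); exact/val_inj.
  move=> [Ax At] i; case: (unliftP ord0 i) => [j|] ->//.
  by rewrite tnthS; have := At j; congr (A _ (tnth _ _)); exact/val_inj.
- rewrite (_ : [set _ | _] =
      \bigcap_i ((fun u : n.-tuple T => tnth u i) @^-1` A (lift ord0 i))).
    apply: fin_bigcap_measurable; first exact: finite_finset.
    move=> i _; rewrite -[X in measurable X]setTI.
    exact: measurable_tnth.
  by apply/seteqP; split=> u /= Au i; [move=> _; exact: Au|exact: Au].
Qed.

End LebesgueTuple.
Arguments lebesgue_tuple {R} n.

Notation spacetime R m := ('rV[R]_m * R)%type.

Section Cone.
Context {R : realType} {m : nat}.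
Local Notation V := (spacetime R m).
Implicit Types f g : V -> R.

(* [Some i] is the i-th coordinate of x, [None] the coordinate t. *)
Definition coord_dir (c : option 'I_m) : V :=
  if c is Some i then (delta_mx 0 i, 0) else (0, 1).

Definition pderive (c : option 'I_m) f : V -> R := 'D_(coord_dir c) f.

Definition smooth f : Prop := forall s : seq (option 'I_m),
  continuous (foldr pderive f s) /\
  forall c p, derivable (foldr pderive f s) p (coord_dir c).

Definition supp f : set V := closure [set p | f p != 0].

Definition test_function f : Prop := smooth f /\ compact (supp f).

Definition dAlembert f : V -> R := fun p =>
  pderive None (pderive None f) p -
  \sum_(i < m) pderive (Some i) (pderive (Some i) f) p.

Definition halfspace (t0 : R) : set V := [set p | p.2 <= t0].

(* The norm [`|u|] of the library on row vectors is the maximum norm. *)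
Definition enorm (u : 'rV[R]_m) : R := Num.sqrt (\sum_(i < m) u 0 i ^+ 2).

Definition row_of_tuple (u : m.-tuple R) : 'rV[R]_m := \row_i tnth u i.

Definition conical_radon f : V -> R := fun p =>
  \int[lebesgue_tuple m]_u
    f (p.1 + row_of_tuple u, p.2 + enorm (row_of_tuple u)).

End Cone.

(* Main.v *)
(** Write m = 2k-1 and let phi be smooth and zero for large t (compact support is
    not needed).  Put [hint l phi p s] = int phi(x+v, t+r) r^-l dv over the
    hyperboloid r = sqrt(|v|^2 + s).  Integration by parts on the hyperboloid gives,
    with H(s) = [hint 0 phi p s], the identity
      [hint 0 (box phi) p s] = 4 (s H''(s) + (1 - k) H'(s)),
    and iterating it, [hint 0 (box^k phi) p s] = 4^k s^k H^(2k)(s).  As s -> 0 the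
    left-hand side tends to C[box^k phi](p), while on the right only the most singular
    term of H^(2k), an integral of r^-(2m+1) d_t phi, survives and rescales to a
    multiple of d_t phi(p).  Hence C[box^k phi] = c d_t phi with c <> 0.

    If g = C[f], then box^k g = C[box^k f] = c d_t f, which yields (i)-(iii).
    Conversely, let h = box^k g and let f be the primitive of h/c in t that vanishes
    for large t; f has compact support by (i) and (ii).  Then
    d_t C[f] = C[h]/c = C[box^k g]/c = d_t g, and both g and C[f] vanish for large t,
    so g = C[f]. *)
Require Import Defs.
From mathcomp Require Import all_boot all_order all_algebra.
From mathcomp Require Import all_classical all_reals all_analysis.
From mathcomp Require Import measurable_realfun ring lra zify.

Set Implicit Arguments.
Unset Strict Implicit.
Unset Printing Implicit Defensive.

Import Order.TTheory GRing.Theory Num.Theory.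
Import numFieldNormedType.Exports.

Local Open Scope classical_set_scope.
Local Open Scope ring_scope.

(** * Directional derivatives *)

(** The detour through hyperboloids is forced by the vertex: derivatives bring down ever higher
    powers of [1/r], and [r^-l] is not integrable over the cone near [v = 0] once [l >= m]. For
    [s > 0] the radius stays above [sqrt s], and differentiation under the integral sign is
    harmless.

    The exponent [2m+1] is found by scaling. With [s = e^2] and [v = e w], the integral of
    [r^-l psi] has order [e^(m-l)] for large [l], while [s^k = e^(2k) = e^(m+1)]. The powers balance
    exactly at [l = 2m+1], and smaller [l] give the limit 0. An [s]-derivative raises [l] by 2 when
    it falls on the weight, and by 1 when it falls on the function. The first of the [2k]
    derivatives meets the weight [r^0], so it must fall on [phi] and leaves [r^-1 d_t phi]. The
    remaining [2k-1 = m] derivatives reach [l = 2m+1] only if all of them fall on the weight. Their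
    coefficients [-l/2] run over odd [l], so none of them is zero. *)

Lemma is_derive_cvg (R : realType) (V : normedModType R) (f : V -> R)
    (p v : V) (df : R) :
  h^-1 * (f (h *: v + p) - f p) @[h --> 0^'] --> df -> is_derive p v f df.
Proof.
move=> fdf; apply: DeriveDef; first by apply/cvg_ex; exists df.
exact/cvg_lim.
Qed.

Section DirectionalDerivative.
Context {R : realType} {V : normedModType R}.
Implicit Types (f : V -> R) (p q v w : V).

Lemma is_derive_line f p v (df : R) :
  is_derive (0 : R) 1 (fun h : R => f (p + h *: v)) df <-> is_derive p v f df.
Proof.
have E : (fun h : R => h^-1 *: (f (p + (h *: (1 : R^o) + 0) *: v) - f (p + 0 *: v))) =
    (fun h : R => h^-1 *: (f (h *: v + p) - f p)).
  by apply/funext => h; rewrite scale0r !addr0 [_ *: 1]mulr1 (addrC p).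
by split=> -[fd fE]; apply: DeriveDef; move: fd fE; rewrite /derivable /derive /= E.
Qed.

Lemma is_derive_lineT f p v (h0 : R) : derivable f (p + h0 *: v) v ->
  is_derive h0 1 (fun h : R => f (p + h *: v)) ('D_v f (p + h0 *: v)).
Proof.
move=> /derivableP fd; apply: is_derive_cvg; case: fd => fd _.
have -> : (fun h : R => h^-1 * (f (p + (h *: (1 : R^o) + h0) *: v) - f (p + h0 *: v))) =
    (fun h => h^-1 *: (f (h *: v + (p + h0 *: v)) - f (p + h0 *: v))).
  by apply/funext => h; rewrite [_ *: 1]mulr1 scalerDl addrCA.
exact: fd.
Qed.

Lemma mean_value_line f p v (h : R) : (forall q, derivable f q v) ->
  exists2 x : R, `|x| <= `|h| & f (p + h *: v) - f p = h * 'D_v f (p + x *: v).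
Proof.
move=> fd.
have fL (x : R) : is_derive x 1 (fun h : R => f (p + h *: v)) ('D_v f (p + x *: v)).
  exact: is_derive_lineT.
have fC (a b : R) : {within `[a, b], continuous (fun h : R => f (p + h *: v))}.
  by apply: derivable_within_continuous => x _; case: (fL x).
have p0 : p + 0 *: v = p by rewrite scale0r addr0.
have [h0|h0] := leP 0 h.
  have [c] := MVT_segment h0 (fun x _ => fL x) (fC 0 h).
  rewrite in_itv/= => /andP[c0 ch]; rewrite p0 subr0 mulrC => E.
  by exists c => //; rewrite !ger0_norm.
have [c] := MVT_segment (ltW h0) (fun x _ => fL x) (fC h 0).
rewrite in_itv/= => /andP[hc c0]; rewrite p0 sub0r mulrN mulrC => E.
exists c; first by rewrite !ler0_norm// ?lerN2// ltW.
by rewrite -[LHS]opprB E opprK.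
Qed.

(** A chain rule in the absence of Fréchet differentiability: only directional derivatives are at
    hand. The increment is split into a step along [v], handled by the mean value theorem and
    continuity of ['D_v f], and a step along [w], handled by the one-variable chain rule. It serves
    for curves on a hyperboloid, with [v] spatial and [w] the time direction. *)
Lemma is_derive_curve f q v w (rho : R -> R) (h0 drho : R) :
    (forall p, derivable f p v) -> continuous ('D_v f) ->
    (forall p, derivable f p w) -> is_derive h0 1 rho drho ->
  is_derive h0 1 (fun h : R => f (q + h *: v + rho h *: w))
    ('D_v f (q + h0 *: v + rho h0 *: w) + drho * 'D_w f (q + h0 *: v + rho h0 *: w)).
Proof.
move=> fv cfv fw drhoP; apply: is_derive_cvg.
set p := q + h0 *: v.
have d2 : is_derive h0 1 (fun h : R => f (p + rho h *: w))
    (drho * 'D_w f (p + rho h0 *: w)).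
  have := is_derive_lineT (fw (p + rho h0 *: w)).
  rewrite mulrC => d2.
  by apply: (@is_derive1_comp _ (fun h : R => f (p + h *: w)) rho).
have crho : rho (h + h0) @[h --> 0^'] --> rho h0.
  have : {for h0, continuous rho}.
    by apply/differentiable_continuous/derivable1_diffP; case: drhoP.
  move=> crho'; apply: (@cvg_comp _ _ _ (fun h => h + h0) rho _ (nbhs h0)) => //.
  have : (h + h0) @[h --> 0^'] --> 0 + h0.
    by apply: cvgD; [exact: nbhs_dnbhs|exact: cvg_cst].
  by rewrite add0r.
(* The intermediate points are chosen as a function of [h], so that a limit can be taken along
   them. *)
pose MV h := cid2 (mean_value_line (p + rho (h + h0) *: w) h fv).
pose xi h := s2val (MV h).
have xi_le h : `|xi h| <= `|h| by exact: s2valP (MV h).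
have xiE h : f (p + rho (h + h0) *: w + h *: v) - f (p + rho (h + h0) *: w) =
    h * 'D_v f (p + rho (h + h0) *: w + xi h *: v) by exact: s2valP' (MV h).
have d1 : 'D_v f (p + rho (h + h0) *: w + xi h *: v) @[h --> 0^'] -->
    'D_v f (p + rho h0 *: w).
  apply: (@cvg_comp _ _ _ (fun h => p + rho (h + h0) *: w + xi h *: v)
    ('D_v f)); last exact: cfv.
  rewrite -[p + rho h0 *: w]addr0; apply: cvgD.
    by apply: cvgD; [exact: cvg_cst|apply: cvgZr_tmp].
  rewrite -(scale0r v); apply: cvgZr_tmp.
  apply/cvgr0Pnorm_lt => e e0; near=> h.
  by apply: le_lt_trans (xi_le h) _; near: h; exact: dnbhs0_lt.
have {d2}[d2 d2E] := d2; rewrite -d2E.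
apply: cvg_trans (cvgD d1 d2).
apply: near_eq_cvg; near=> h.
have h0' : h != 0 by near: h; exact: nbhs_dnbhs_neq.
change ('D_v f (p + rho (h + h0) *: w + xi h *: v) +
    h^-1 * (f (p + rho (h *: (1 : R^o) + h0) *: w) - f (p + rho h0 *: w)) =
  h^-1 * (f (q + (h *: (1 : R^o) + h0) *: v + rho (h *: (1 : R^o) + h0) *: w) -
    f (p + rho h0 *: w))).
rewrite [h *: (1 : R^o)]mulr1 -['D_v f _](mulKf h0') -xiE -mulrDr; congr (_ * _).
rewrite /p !scalerDl.
have -> : q + (h *: v + h0 *: v) + rho (h + h0) *: w =
  q + h0 *: v + rho (h + h0) *: w + h *: v
  by rewrite (addrC (h *: v)) addrA [LHS]addrAC.
by rewrite addrA subrK.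
Unshelve. all: by end_near. Qed.

Lemma is_derive_translate f p c v (df : R) :
  is_derive (p + c) v f df -> is_derive p v (fun q => f (q + c)) df.
Proof.
move=> /is_derive_line fd; apply/is_derive_line.
by under eq_fun do rewrite addrAC.
Qed.

(** The mean value theorem applied twice: along [v] to the difference [f (q + h w) - f q], then
    along [w] to ['D_v f]. *)
Lemma second_difference f p v w (h : R) :
    (forall q, derivable f q v) -> (forall q, derivable ('D_v f) q w) ->
  exists x y : R, [/\ `|x| <= `|h|, `|y| <= `|h| &
    f (p + h *: v + h *: w) - f (p + h *: v) - (f (p + h *: w) - f p) =
    h * h * 'D_w ('D_v f) (p + x *: v + y *: w)].
Proof.
move=> fv fvw; pose g q := f (q + h *: w) - f q.
have gd q : is_derive q v g ('D_v f (q + h *: w) - 'D_v f q).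
  apply: is_deriveB; last exact/derivableP.
  exact/is_derive_translate/derivableP.
have [x xh gE] : exists2 x : R, `|x| <= `|h| &
    g (p + h *: v) - g p = h * 'D_v g (p + x *: v).
  by apply: mean_value_line => q; case: (gd q).
have [y yh fE] := mean_value_line (p + x *: v) h fvw.
exists x, y; split => //.
have -> : f (p + h *: v + h *: w) - f (p + h *: v) - (f (p + h *: w) - f p) =
  g (p + h *: v) - g p by [].
by rewrite gE -mulrA -fE; case: (gd (p + x *: v)) => _ ->.
Qed.

(** The second difference is symmetric in [v] and [w], so for small [h] the two mixed derivatives
    share a value at points arbitrarily close to [p]; continuity brings this to [p]. *)
Lemma derive_comm f p v w :
    (forall q, derivable f q v) -> (forall q, derivable f q w) ->
    (forall q, derivable ('D_v f) q w) -> (forall q, derivable ('D_w f) q v) ->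
    continuous ('D_w ('D_v f)) -> continuous ('D_v ('D_w f)) ->
  'D_w ('D_v f) p = 'D_v ('D_w f) p.
Proof.
move=> fv fw fvw fwv cvw cwv; set a := LHS; set b := RHS.
apply/eqP; rewrite -subr_eq0 -normr_le0; apply/ler_addgt0Pl => e e0.
rewrite addr0.
have e20 : 0 < e / 2 by rewrite divr_gt0.
have /cvgrPdist_lt /(_ _ e20) /nbhs_ballP[d1 /= d10 D1] := cvw p.
have /cvgrPdist_lt /(_ _ e20) /nbhs_ballP[d2 /= d20 D2] := cwv p.
pose d := Num.min d1 d2; have d0 : 0 < d by rewrite lt_min d10.
(* With [h = d / c], every point [p + x v + y w] with [x] and [y] at most [h] in absolute value is
   within [d] of [p]; the summand 1 keeps [c] positive. *)
pose c := `|v| + `|w| + 1.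
have c0 : 0 < c by rewrite ltr_wpDl// addr_ge0.
pose h := d / c; have h0 : 0 < h by rewrite divr_gt0.
have close (x y : R) : `|x| <= `|h| -> `|y| <= `|h| ->
    `|p - (p + x *: v + y *: w)| < d.
  move=> xh yh; rewrite -addrA opprD addrA subrr sub0r normrN.
  apply: (le_lt_trans (ler_normD _ _)); rewrite !normrZ.
  apply: (@le_lt_trans _ _ (h * (`|v| + `|w|))).
    by rewrite mulrDr lerD// ler_wpM2r// -[leRHS]gtr0_norm.
  by rewrite /h mulrAC ltr_pdivrMr// ltr_pM2l// /c ltrDl.
have [x1 [y1 [x1h y1h E1]]] := second_difference p h fv fvw.
have [x2 [y2 [x2h y2h E2]]] := second_difference p h fw fwv.
have E : 'D_w ('D_v f) (p + x1 *: v + y1 *: w) = 'D_v ('D_w f) (p + x2 *: w + y2 *: v).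
  apply: (mulfI (x := h * h)); first by rewrite mulf_neq0// gt_eqF.
  rewrite -E1 -E2 (addrAC p (h *: w)); ring.
have A : `|a - 'D_w ('D_v f) (p + x1 *: v + y1 *: w)| < e / 2.
  apply: D1; rewrite -ball_normE /=; apply: lt_le_trans (close _ _ x1h y1h) _.
  by rewrite ge_min lexx.
have B : `|b - 'D_v ('D_w f) (p + x2 *: w + y2 *: v)| < e / 2.
  apply: D2; rewrite -ball_normE /= addrAC.
  apply: lt_le_trans (close _ _ y2h x2h) _.
  by rewrite ge_min lexx orbT.
rewrite -E in B; rewrite (splitr e) -(subrKA ('D_w ('D_v f) (p + x1 *: v + y1 *: w))).
apply: (le_trans (ler_normD _ _)); apply: lerD; first exact: ltW A.
rewrite distrC; exact: ltW B.
Qed.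

End DirectionalDerivative.

(** * Integration over tuples *)

Lemma rV_norm_le (R : realType) m (v : 'rV[R]_m) (r : R) : 0 <= r ->
  (`|v| <= r) <-> (forall i, `|v 0 i| <= r).
Proof.
move=> r0; change (mx_norm v <= r <-> forall i, `|v 0 i| <= r); rewrite mx_normrE.
split=> [/bigmax_leP[_ vr] i|vr]; first exact: (vr (ord0, i) isT).
by apply/bigmax_leP; split => // -[a i] _; rewrite (ord1 a).
Qed.

Lemma rV_norm_lt (R : realType) m (v : 'rV[R]_m) (r : R) : 0 < r ->
  (forall i, `|v 0 i| < r) -> `|v| < r.
Proof.
move=> r0 vr; change (mx_norm v < r); rewrite mx_normrE.
by apply/bigmax_ltP; split => // -[a i] _; rewrite (ord1 a).
Qed.

Section MeasureOnTuples.
Context {R : realType}.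
Local Notation T := (measurableTypeR R).

(* The sigma-algebra on tuples is generated by the coordinates; an open set is a
   countable union of cubes with rational centres. *)
Lemma measurable_row_open m (U : set 'rV[R]_m) : open U ->
  measurable ((@row_of_tuple R m : m.-tuple T -> 'rV[R]_m) @^-1` U).
Proof.
move=> oU.
pose cube (c : {ffun 'I_m -> rat} * nat) : set 'rV[R]_m :=
  [set u | forall i, `|ratr (c.1 i) - u 0 i| < c.2.+1%:R^-1].
pose W (n : nat) : set 'rV[R]_m :=
  if @unpickle ({ffun 'I_m -> rat} * nat)%type n is Some c
  then (if `[< cube c `<=` U >] then cube c else set0) else set0.
have UE : U = \bigcup_n W n.
  apply/seteqP; split=> [u Uu|u [n _]]; last first.
    by rewrite /W; case: unpickle => [c|//]; case: asboolP => // + uc; exact.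
  move: oU; rewrite openE => /(_ _ Uu) /nbhs_ballP[e /= e0 eU].
  have [n ne] : exists n : nat, n.+1%:R^-1 < e / 2.
    have /ltr_add_invr[n] : (0 < e / 2) by rewrite divr_gt0.
    by rewrite add0r; exists n.
  have qP i : exists q : rat, `|ratr q - u 0 i| < n.+1%:R^-1.
    have [q] : exists q : rat, ratr q \in `](u 0 i - n.+1%:R^-1), (u 0 i + n.+1%:R^-1)[%R.
      apply: rat_in_itvoo; rewrite ltrBlDr -addrA ltrDl addr_gt0//.
    by rewrite in_itv/= => qu; exists q; rewrite ltr_distl.
  pose c : {ffun 'I_m -> rat} * nat := ([ffun i => projT1 (cid (qP i))], n).
  have cu : cube c u by move=> i /=; rewrite ffunE; case: cid.
  exists (pickle c) => //; rewrite /W pickleK; case: asboolP => // ncU; exfalso.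
  apply: ncU => v cv; apply: eU; rewrite -ball_normE /=.
  apply: rV_norm_lt => // i; rewrite !mxE.
  rewrite -(subrKA (ratr (c.1 i))).
  apply: (le_lt_trans (ler_normD _ _)); rewrite (splitr e) ltrD//.
    by rewrite distrC; apply: lt_trans ne; exact: cu.
  by apply: lt_trans ne; exact: cv.
rewrite UE preimage_bigcup; apply: bigcupT_measurable => n.
rewrite /W; case: unpickle => [c|]; last by rewrite preimage_set0.
case: asboolP => _; last by rewrite preimage_set0.
rewrite (_ : _ @^-1` _ = \bigcap_i ((fun u : m.-tuple T => tnth u i) @^-1`
    [set x | `|ratr (c.1 i) - x| < c.2.+1%:R^-1])).
  apply: fin_bigcap_measurable; first exact: finite_finset.
  move=> i _; rewrite -[X in measurable X]setTI.
  apply: measurable_tnth => //; rewrite (_ : [set x | _] =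
    ball (ratr (c.1 i) : R) c.2.+1%:R^-1); last by rewrite -ball_normE.
  by apply: open_measurable; exact: ball_open.
apply/seteqP; split=> u /= uc i; first by move=> _; have := uc i; rewrite mxE.
by rewrite mxE; exact: uc.
Qed.

Lemma measurable_row_continuous m (F : 'rV[R]_m -> R) : continuous F ->
  measurable_fun setT (fun u : m.-tuple T => F (row_of_tuple u)).
Proof.
move=> /continuousP cF; apply: (measurability _ (RGenOpens.measurableE R)).
move=> _ [_ [a [b ->] <-]]; rewrite setTI.
have := measurable_row_open (U := F @^-1` `]a, b[); apply.
by apply: cF; exact: interval_open.
Qed.

Definition box m (r : R) : set (m.-tuple T) := [set u | `|row_of_tuple u| <= r].

Lemma boxE m (r : R) : 0 <= r ->
  box r = [set u : m.-tuple T | forall i, `[- r, r]%classic (tnth u i)].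
Proof.
move=> r0; apply/seteqP; split=> u; rewrite /box /=.
  by move=> /(rV_norm_le _ r0) ur i; have := ur i; rewrite mxE in_itv/= ler_norml.
by move=> ur; apply/(rV_norm_le _ r0) => i; have := ur i; rewrite mxE in_itv/= ler_norml.
Qed.

Lemma measurable_box m (r : R) : measurable (@box m r).
Proof.
have -> : box r = (@row_of_tuple R m : m.-tuple T -> _) @^-1` ~` [set v | r < `|v|].
  apply/seteqP; split=> u; rewrite /box /=; first by move=> ur; apply/negP; rewrite -leNgt.
  by move/negP; rewrite -leNgt.
rewrite preimage_setC; apply: measurableC.
have := measurable_row_open (U := [set v : 'rV[R]_m | r < `|v|]); apply.
by apply: open_comp (@open_gt R r) => v _; exact: norm_continuous.
Qed.

Lemma lebesgue_box_lty m (r : R) : (lebesgue_tuple m (@box m r) < +oo)%E.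
Proof.
have [r0|r0] := leP 0 r; last first.
  rewrite (_ : box r = set0) ?measure0//; apply/seteqP; split=> // u /=.
  by rewrite /box/= => /(le_trans (normr_ge0 _)); rewrite leNgt r0.
rewrite boxE// (lebesgue_tuple_box (A := fun=> `[- r, r]%classic)).
  2: by move=> i; exact: measurable_itv.
rewrite ltey_eq; apply/orP; left; apply: prode_fin_num => i _.
by rewrite lebesgue_measure_itv/=; case: ifP.
Qed.

End MeasureOnTuples.

(** * Differentiation under the integral sign *)

Section BoundedIntegrand.
Context {R : realType} d {Y : measurableType d} (mu : {measure set Y -> \bar R}).

Lemma integrable_bounded (A : set Y) (F : Y -> R) (M : R) :
    measurable A -> (mu A < +oo)%E -> measurable_fun setT F ->
    (forall y, `|F y| <= M) -> (forall y, ~ A y -> F y = 0) ->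
  mu.-integrable setT (EFin \o F).
Proof.
move=> mA Afin mF FM FA.
have -> : EFin \o F = (EFin \o F) \_ A.
  apply/funext => y; rewrite patchE; case: ifPn => //.
  by rewrite notin_setE => /FA /= ->.
apply/integrable_restrict => //; rewrite setTI.
apply: measurable_bounded_integrable => //; first exact: measurable_funTS.
exists M; split=> [|x Mx y _ /=]; first exact: num_real.
exact/(le_trans (FM y))/ltW.
Qed.

(** One set [A] of finite measure carries all the integrands near [a], so a constant times its
    indicator is an integrable majorant of the derivatives. *)
Lemma is_derive_integral (A : set Y) (F F' : R -> Y -> R) (a e M : R) :
    0 < e -> measurable A -> (mu A < +oo)%E ->
    (forall x, `|x - a| < e -> measurable_fun setT (F x)) ->
    (forall x y, `|x - a| < e -> is_derive x 1 (F ^~ y) (F' x y)) ->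
    (forall x y, `|x - a| < e -> ~ A y -> F x y = 0) ->
    (forall x y, `|x - a| < e -> `|F x y| <= M) ->
    (forall x y, `|x - a| < e -> `|F' x y| <= M) ->
  is_derive a 1 (fun x => \int[mu]_y F x y) (\int[mu]_y F' a y).
Proof.
move=> e0 mA Afin mF dF FA FM F'M.
have near_a x : `]a - e, a + e[%classic x -> `|x - a| < e.
  by rewrite /= in_itv/= ltr_distl.
have aI : `]a - e, a + e[%classic a by rewrite /= in_itv/= ltrBlDr ltrDl e0.
have d1E x y : `|x - a| < e -> partial1of2 F x y = F' x y.
  by move=> xa; rewrite partial1of2E; case: (dF x y xa).
(* Off [A] the function vanishes for all parameters near [x], hence so does its derivative. *)
have F'A x y : `|x - a| < e -> ~ A y -> F' x y = 0.
  move=> xa Ay; have [fd <-] := dF x y xa.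
  rewrite -(derive_cst (0 : R^o) x (1 : R^o)); apply: near_eq_derive.
  have := @near_in_itvoo R (a - e) (a + e) x.
  rewrite in_itv/= -ltr_distl => /(_ xa); apply: filterS => z.
  by rewrite in_itv/= -ltr_distl => za; exact: FA.
have G : is_derive a 1 (fun x => \int[mu]_y F x y)
    (\int[mu]_(y in setT) partial1of2 F a y).
  have H := @cvg_differentiation_under_integral _ _ _ mu F setT measurableT a _ _ aI _ _
      (fun y => `|M| * \1_A y).
  apply: is_derive_cvg; under eq_fun do rewrite [_ *: 1]mulr1; apply: H.
  - move=> x /near_a xa; apply: (integrable_bounded mA Afin (mF _ xa) (M := M)) => y.
      exact: FM.
    exact: FA.
  - by move=> x y /near_a xa _; case: (dF x y xa).
  - by move=> y; rewrite mulr_ge0.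
  - apply: (integrable_bounded mA Afin _ (M := `|M|)) => [|y|y Ay].
    + by apply: measurable_funM => //; exact: measurable_indic.
    + rewrite normrM normr_id ler_piMr// indicE; case: (_ \in _); rewrite ?normr1 ?normr0//.
    + by rewrite indicE memNset// mulr0.
  - move=> x y /near_a xa _; rewrite d1E//; have [Ay|Ay] := pselect (A y).
      rewrite indicE mem_set// mulr1; exact: (le_trans (F'M x y xa) (ler_norm _)).
    by rewrite F'A// normr0 indicE memNset// mulr0.
have -> : \int[mu]_y F' a y = \int[mu]_y partial1of2 F a y; last exact: G.
 apply: eq_Rintegral => y _; by rewrite d1E//; exact: near_a.
Qed.

End BoundedIntegrand.

(** * Affine changes of variables and an integrable majorant on tuples *)

Section ChangeOfVariables.
Context {R : realType}.
Local Notation T := (measurableTypeR R).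
Local Notation mu := (@lebesgue_measure R).

Lemma continuous_affine (a b : R) : continuous (fun x : R => a * x + b).
Proof. by move=> x; apply: cvgD; [exact: mulrl_continuous|exact: cvg_cst]. Qed.

Lemma ge0_integral_affine (a b : R) (f : T -> \bar R) : 0 < a ->
    measurable_fun setT f -> (forall x, (0 <= f x)%E) ->
  (\int[mu]_x f (a * x + b)%R = (a^-1)%:E * \int[mu]_x f x)%E.
Proof.
move=> a0 mf f0; pose phi : T -> T := fun x => a * x + b.
have mphi : measurable_fun setT phi.
  by apply: continuous_measurable_fun; exact: continuous_affine.
pose nu : {measure set T -> \bar R} := mscale (NngNum (ltW a0)) (pushforward mu phi).
(* By uniqueness of Lebesgue measure: [a] times the image of [mu] under [phi] gives half-open
   intervals their length. *)
have E : (\int[mu]_x f x = \int[nu mphi]_x f x)%E.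
  apply: eq_measure_integral => A mA _; apply: lebesgue_measure_unique => //.
  move=> _ [[x y] _ <-]; rewrite /nu /mscale /pushforward /=.
  change (mu `]x, y]%classic = a%:E * mu (phi @^-1` `]x, y]%classic))%E.
  rewrite (_ : phi @^-1` _ = `](x - b) / a, (y - b) / a]%classic); last first.
    apply/seteqP; split=> z /=; rewrite !in_itv/= /phi;
      by rewrite ltr_pdivrMr// ler_pdivlMr// ltrBlDr lerBrDr [z * a]mulrC.
  rewrite !lebesgue_measure_itv/= !lte_fin ltr_pM2r ?invr_gt0// ltrBlDr subrK.
  case: ifPn => _; last by rewrite mule0.
  by rewrite -!EFinB -EFinM; congr (_%:E); field; rewrite gt_eqF.
rewrite E ge0_integral_mscale// ge0_integral_pushforward//.
by rewrite muleA -EFinM mulVf ?gt_eqF// mul1e.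
Qed.

Lemma ge0_integral_tuple_cons n (f : n.+1.-tuple T -> \bar R) :
    measurable_fun setT f -> (forall u, (0 <= f u)%E) ->
  (\int[lebesgue_tuple n.+1]_u f u =
   \int[mu]_x \int[lebesgue_tuple n]_v f (pair_cons (x, v)))%E.
Proof.
move=> mf f0.
transitivity (\int[pushforward (mu \x lebesgue_tuple n)%E (@pair_cons R n)]_u f u)%E.
  apply: eq_measure_integral; first exact: measurable_pair_cons.
  by [].
rewrite ge0_integral_pushforward//; last exact: measurable_pair_cons.
rewrite preimage_setT fubini_tonelli1//; last by move=> x; exact: f0.
by apply: measurableT_comp => //; exact: measurable_pair_cons.
Qed.

Lemma measurable_tuple_section n (f : n.+1.-tuple T -> \bar R) (x : T) :
  measurable_fun setT f -> measurable_fun setT (fun v => f (pair_cons (x, v))).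
Proof.
move=> mf; apply: measurableT_comp => //.
apply: (@measurableT_comp _ _ _ _ _ _ (@pair_cons R n)).
  exact: measurable_pair_cons.
exact: measurable_pair1.
Qed.

Lemma measurable_tuple_integral n (f : n.+1.-tuple T -> \bar R) :
    measurable_fun setT f -> (forall u, (0 <= f u)%E) ->
  measurable_fun setT (fun x : T => \int[lebesgue_tuple n]_v f (pair_cons (x, v)))%E.
Proof.
move=> mf f0.
apply: (@measurable_fun_fubini_tonelli_F _ _ T _ R (lebesgue_tuple n) (f \o @pair_cons R n)) => //; last first.
  by move=> x; exact: f0.
by apply: measurableT_comp => //; exact: measurable_pair_cons.
Qed.

Definition tuple_affine n (a : R) (b u : n.-tuple T) : n.-tuple T :=
  [tuple (a * tnth u i + tnth b i : T) | i < n].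

Lemma measurable_tuple_affine n (a : R) (b : n.-tuple T) :
  measurable_fun setT (tuple_affine a b).
Proof.
apply/measurable_fun_tnthP => i.
have -> : (@tnth n T)^~ i \o tuple_affine a b =
    (fun x : T => a * x + tnth b i) \o (fun u : n.-tuple T => tnth u i).
  by apply/funext => u /=; rewrite tnth_mktuple.
apply: measurableT_comp; last exact: measurable_tnth.
by apply: continuous_measurable_fun; exact: continuous_affine.
Qed.

Lemma ge0_integral_tuple_affine n (a : R) (b : n.-tuple T) (f : n.-tuple T -> \bar R) :
    0 < a -> measurable_fun setT f -> (forall u, (0 <= f u)%E) ->
  (\int[lebesgue_tuple n]_u f (tuple_affine a b u) =
   ((a^-1) ^+ n)%:E * \int[lebesgue_tuple n]_u f u)%E.
Proof.
move=> a0; elim: n b f => [|n IHn] b f mf f0.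
  rewrite expr0 mul1e; apply: eq_integral => u _; congr f.
  by rewrite [LHS]tuple0 [RHS]tuple0.
rewrite !ge0_integral_tuple_cons//; last first.
  by apply: measurableT_comp => //; exact: measurable_tuple_affine.
pose g x := (\int[lebesgue_tuple n]_v f (pair_cons (x, v)))%E.
have g0 x : (0 <= g x)%E by exact: integral_ge0.
have mg : measurable_fun setT g by exact: measurable_tuple_integral.
transitivity (\int[mu]_x (((a^-1) ^+ n)%:E * g (a * x + thead b)%R))%E.
  apply: eq_integral => x _; rewrite /g -(IHn [tuple of behead b])//; last first.
    exact: measurable_tuple_section.
  apply: eq_integral => v _; congr f; apply/eq_from_tnth => i.
  rewrite tnth_mktuple /pair_cons /=; case: (unliftP ord0 i) => [j|] ->.
    rewrite !tnthS tnth_mktuple; congr (_ * _ + _).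
    rewrite [RHS]tnth_behead; congr (tnth b _); apply/val_inj.
    by rewrite /= inordK// ltnS ltn_ord.
  by [].
rewrite ge0_integralZl//; last 2 first.
- apply: measurableT_comp => //; apply: continuous_measurable_fun.
  exact: continuous_affine.
- by rewrite lee_fin exprn_ge0// invr_ge0 ltW.
by rewrite ge0_integral_affine// muleA -EFinM -exprSr.
Qed.

(** Used in two special cases: [a = 1] is translation invariance, the source of integration by
    parts, and [b = 0] is the dilation that rescales hyperboloids. *)
Lemma Rintegral_row_affine m (a : R) (b : 'rV[R]_m) (G : 'rV[R]_m -> R) :
    0 < a -> (lebesgue_tuple m).-integrable setT (fun u => (G (row_of_tuple u))%:E) ->
  \int[lebesgue_tuple m]_u G (a *: row_of_tuple u + b) =
  (a^-1) ^+ m * \int[lebesgue_tuple m]_u G (row_of_tuple u).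
Proof.
move=> a0 iG; pose f u := (G (row_of_tuple u))%:E.
pose c : m.-tuple T := [tuple (b 0 i : T) | i < m].
have -> : \int[lebesgue_tuple m]_u G (a *: row_of_tuple u + b) =
    fine (\int[lebesgue_tuple m]_u (f (tuple_affine a c u)))%E.
  congr fine; apply: eq_integral => u _; congr ((G _)%:E).
  by apply/rowP => i; rewrite !mxE tnth_mktuple tnth_mktuple.
have mf : measurable_fun setT f by exact: (measurable_int _ iG).
rewrite /Rintegral [X in fine X = _]integralE [X in _ = _ * fine X]integralE.
have -> : ((fun u => f (tuple_affine a c u))^\+ = f^\+ \o tuple_affine a c)%E.
  exact: (funepos_comp f).
have -> : ((fun u => f (tuple_affine a c u))^\- = f^\- \o tuple_affine a c)%E.
  exact: (funeneg_comp f).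
rewrite !ge0_integral_tuple_affine//; last 2 first.
- exact: measurable_funeneg.
- exact: measurable_funepos.
have := integrable_pos_fin_num measurableT iG.
have := integrable_neg_fin_num measurableT iG.
rewrite -/f => /fineK <- /fineK <-.
by rewrite -!EFinM -!EFinB /= mulrBr.
Qed.

(** A majorant in product form: Tonelli reduces its integral to that of [1 / (1 + x^2)], so no polar
    coordinates are needed to integrate negative powers of the radius. *)
Lemma integrable_prod_oneDsqrV n : (lebesgue_tuple n).-integrable setT
  (fun u : n.-tuple T => (\prod_(i < n) (oneDsqr (tnth u i))^-1)%:E).
Proof.
have mh : measurable_fun setT (fun x : T => (oneDsqr x)^-1).
  by apply: continuous_measurable_fun; exact: continuous_oneDsqrV.
have mP k : measurable_fun setT
    (fun u : k.-tuple T => \prod_(i < k) (oneDsqr (tnth u i))^-1).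
  apply: measurable_prod => i _; apply: (measurableT_comp mh).
  exact: measurable_tnth.
have h0 (x : R) : 0 <= (oneDsqr x)^-1 by rewrite invr_ge0 ltW// oneDsqr_gt0.
have P0 k (u : k.-tuple T) : 0 <= \prod_(i < k) (oneDsqr (tnth u i))^-1.
  by apply: prodr_ge0 => i _.
apply/integrableP; split; first by apply/measurable_EFinP; exact: mP.
under eq_integral do rewrite gee0_abs ?lee_fin//.
elim: n => [|n IHn].
  under eq_integral do rewrite big_ord0.
  by rewrite integral_cst// mul1e /= diracT ltry.
(* By evenness this is twice the integral over the half-line, which is known. *)
have h_lty : (\int[mu]_x ((oneDsqr x)^-1)%:E < +oo)%E.
  rewrite (ge0_symfun_integralT (f := fun x => (oneDsqr x)^-1))//; last 2 first.
  - exact: continuous_oneDsqrV.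
  - by move=> x /=; rewrite /oneDsqr sqrrN.
  by rewrite -set_itvcy integral0y_oneDsqr -EFinM ltry.
rewrite ge0_integral_tuple_cons//; last 2 first.
- by apply/measurable_EFinP; exact: mP.
- by move=> u; rewrite lee_fin.
pose c : \bar R := (\int[lebesgue_tuple n]_u (\prod_(i < n) (oneDsqr (tnth u i))^-1)%:E)%E.
have c0 : (0 <= c)%E by apply: integral_ge0 => u _; rewrite lee_fin.
have cE : c = (fine c)%:E by rewrite fineK// ge0_fin_numE.
have -> : (\int[mu]_x \int[lebesgue_tuple n]_v
    (\prod_(i < n.+1) (oneDsqr (tnth (pair_cons (x, v)) i))^-1)%:E =
    \int[mu]_x ((oneDsqr x)^-1%:E * c))%E.
  apply: eq_integral => x _.
  rewrite -ge0_integralZl//; last 2 first.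
  - by apply/measurable_EFinP; exact: mP.
  - by move=> u _; rewrite lee_fin.
  apply: eq_integral => v _; rewrite -EFinM; congr (_%:E).
  rewrite big_ord_recl /pair_cons /= tnth0; congr (_ * _).
  apply: eq_bigr => i _; rewrite tnthS; congr ((oneDsqr (tnth _ _))^-1).
rewrite cE ge0_integralZr//; last 2 first.
- by apply/measurable_EFinP; exact: mh.
- by rewrite -cE.
by rewrite muleC -cE lte_mul_pinfty// cE.
Qed.

End ChangeOfVariables.

(** * Smooth functions vanishing in the future *)

Section Smooth.
Context {R : realType} {m : nat}.
Local Notation V := (spacetime R m).
Implicit Types (f g : V -> R) (p : V) (c : option 'I_m).

Lemma smooth_continuous f : smooth f -> continuous f.
Proof. by move=> /(_ [::])[]. Qed.

Lemma smooth_derivable f c p : smooth f -> derivable f p (coord_dir c).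
Proof. by move=> /(_ [::])[_]; exact. Qed.

Lemma smooth_pderive f c : smooth f -> smooth (pderive c f).
Proof.
by move=> sf s; have := sf (rcons s c); rewrite foldr_rcons.
Qed.

Lemma pderiveC f c d : smooth f -> pderive c (pderive d f) = pderive d (pderive c f).
Proof.
move=> sf; apply/funext => p.
by apply: derive_comm => [q|q|q|q||]; first [exact: smooth_derivable
  |exact/smooth_derivable/smooth_pderive
  |exact/smooth_continuous/smooth_pderive/smooth_pderive].
Qed.

Lemma smooth_linear (a : R) f g : smooth f -> smooth g ->
  smooth (fun p => f p + a * g p).
Proof.
move=> sf sg.
have E s : foldr pderive (fun p => f p + a * g p) s =
    fun p => foldr pderive f s p + a * foldr pderive g s p.
  elim: s => //= c s ->; apply/funext => p; rewrite /pderive.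
  have df := (sf s).2 c p; have dg := (sg s).2 c p.
  rewrite (deriveD (f := foldr pderive f s) (g := fun p => a * foldr pderive g s p))//.
    by congr (_ + _); exact: (deriveZ a dg).
  exact: (@derivableZ _ _ _ (foldr pderive g s) a).
move=> s; rewrite E; have [cf df] := sf s; have [cg dg] := sg s; split=> [p|c p].
  apply: cvgD; first exact: cf.
  by apply: cvgM; [exact: cvg_cst|exact: cg].
apply: derivableD; first exact: df.
exact: (@derivableZ _ _ _ (foldr pderive g s) a).
Qed.

Lemma smooth0 : smooth (fun _ : V => 0 : R).
Proof.
have E s : foldr pderive (fun _ : V => 0 : R) s = fun _ => 0.
  by elim: s => //= c s ->; apply/funext => p; exact: (derive_cst (0 : R^o)).
move=> s; rewrite E; split=> [p|c p]; first exact: cvg_cst.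
exact: (derivable_cst (0 : R^o)).
Qed.

Lemma smooth_sum (I : Type) (s : seq I) (F : I -> V -> R) :
  (forall i, smooth (F i)) -> smooth (fun p => \sum_(i <- s) F i p).
Proof.
move=> sF; elim: s => [|i s IHs].
  by under eq_fun do rewrite big_nil; exact: smooth0.
under eq_fun do rewrite big_cons -[X in _ + X]mul1r.
exact: smooth_linear.
Qed.

Lemma smooth_dAlembert f : smooth f -> smooth (dAlembert f).
Proof.
move=> sf; rewrite /dAlembert.
under eq_fun do rewrite -mulN1r.
apply: smooth_linear; first exact/smooth_pderive/smooth_pderive.
by apply: smooth_sum => i; exact/smooth_pderive/smooth_pderive.
Qed.

Lemma smooth_iter_dAlembert n f : smooth f -> smooth (iter n dAlembert f).
Proof. by move=> sf; elim: n => //= n; exact: smooth_dAlembert. Qed.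

(** A forward cone meets the region [p.2 <= t0] in a bounded set, so this condition makes the cone
    and hyperboloid integrals converge. Both compact support and condition (iii) provide it. *)
Definition past (t0 : R) f := forall p, t0 < p.2 -> f p = 0.

Lemma past_pderive t0 f c : past t0 f -> past t0 (pderive c f).
Proof.
move=> pf p tp.
rewrite /pderive -(derive_cst (0 : R^o) p (coord_dir c)); apply: near_eq_derive.
have : open [set q : V | t0 < q.2].
  by apply: open_comp (@open_gt R t0) => q _; exact: cvg_snd.
by rewrite openE => /(_ _ tp); apply: filterS => q; exact: pf.
Qed.

Lemma past_dAlembert t0 f : past t0 f -> past t0 (dAlembert f).
Proof.
move=> pf p tp; rewrite /dAlembert.
rewrite (past_pderive _ (past_pderive _ pf))// big1 ?subr0// => i _.
exact: past_pderive _ (past_pderive _ pf) _ tp.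
Qed.

Lemma past_iter_dAlembert t0 n f : past t0 f -> past t0 (iter n dAlembert f).
Proof. by move=> pf; elim: n => //= n; exact: past_dAlembert. Qed.

Definition wave_source t0 f := smooth f /\ past t0 f.

Lemma wave_source_pderive t0 c f : wave_source t0 f -> wave_source t0 (pderive c f).
Proof. by move=> [sf pf]; split; [exact: smooth_pderive|exact: past_pderive]. Qed.

Lemma wave_source_iter_dAlembert t0 n f :
  wave_source t0 f -> wave_source t0 (iter n dAlembert f).
Proof.
by move=> [sf pf]; split; [exact: smooth_iter_dAlembert|exact: past_iter_dAlembert].
Qed.

Lemma compact_box (r : R) :
  compact ([set v : 'rV[R]_m | `|v| <= r] `*` `[- r, r]%classic).
Proof.
apply: compact_setX; last exact: segment_compact.
apply: bounded_closed_compact.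
  by exists r; split=> [|x rx v /= vr]; [exact: num_real|exact: le_trans vr (ltW rx)].
have -> : [set v : 'rV[R]_m | `|v| <= r] = ~` [set v | r < `|v|].
  apply/seteqP; split=> v /=; first by move=> vr; apply/negP; rewrite -leNgt.
  by move/negP; rewrite -leNgt.
apply: open_closedC.
by apply: open_comp (@open_gt R r) => v _; exact: norm_continuous.
Qed.

Lemma bounded_on_box f (r : R) : continuous f ->
  exists M : R, forall p : V, `|p.1| <= r -> `|p.2| <= r -> `|f p| <= M.
Proof.
move=> cf; set K := [set v : 'rV[R]_m | `|v| <= r] `*` `[- r, r]%classic.
have /compact_bounded[M [_ MP]] : compact (f @` K).
  apply: continuous_compact; last exact: compact_box.
  exact: continuous_subspaceT.
exists (M + 1) => p p1 p2; apply: (MP (M + 1)); first by rewrite ltrDl.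
by exists p => //; split => //=; rewrite in_itv/= -ler_norml.
Qed.

End Smooth.

Lemma prod_norm_le (R : realType) (U W : normedModType R) (p : U * W) (r : R) :
  (`|p| <= r) = (`|p.1| <= r) && (`|p.2| <= r).
Proof. by rewrite -ge_max. Qed.

Lemma compact_norm_le (R : realType) m (rho : R) :
  compact [set p : spacetime R m | `|p| <= rho].
Proof.
have -> : [set p : spacetime R m | `|p| <= rho] =
    [set v : 'rV[R]_m | `|v| <= rho] `*` `[- rho, rho]%classic.
  apply/seteqP; split=> p; rewrite /= prod_norm_le in_itv/= ler_norml.
    by move=> /andP[-> ->].
  by move=> [-> ->].
exact: compact_box.
Qed.

(** * Superpositions of translates *)

Section Superpose.
Context {R : realType} {m : nat} d {Y : measurableType d}.
Local Notation V := (spacetime R m).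
Variables (mu : {measure set Y -> \bar R}) (gamma : Y -> V) (w : Y -> R) (W : R).
Hypothesis mgamma : forall f : V -> R, continuous f ->
  measurable_fun setT (fun y => f (gamma y)).
(** Properness towards the future: if [f] vanishes after time [t0], only parameters from a set of
    finite measure, with bounded image under [gamma], contribute to the integral. *)
Hypothesis gamma_proper : forall b : R, exists (A : set Y) (rho : R),
  [/\ measurable A, (mu A < +oo)%E & forall y, (gamma y).2 <= b ->
    [/\ A y, `|(gamma y).1| <= rho & `|(gamma y).2| <= rho]].
Hypothesis mw : measurable_fun setT w.
Hypothesis wW : forall y, `|w y| <= W.
Implicit Types (f : V -> R) (p q : V).

(* The transform C, its smoothings over hyperboloids (with a power of the radius
   as weight) and integration along the half-line t >= 0 are all of this form. *)
Definition superpose f p : R := \int[mu]_y (w y * f (p + gamma y)).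

Lemma translate_continuous f p : continuous f -> continuous (fun q => f (p + q)).
Proof.
move=> cf q; apply: (@cvg_comp _ _ _ (fun q => p + q) f); last exact: cf.
by apply: cvgD; [exact: cvg_cst|exact: cvg_id].
Qed.

Lemma superpose_measurable f p : continuous f ->
  measurable_fun setT (fun y => w y * f (p + gamma y)).
Proof.
move=> cf; apply: measurable_funM => //.
by apply: (mgamma (f := fun q => f (p + q))); exact: translate_continuous.
Qed.

(** A single pair [A], [M] serves all base points [q] within distance 1 of [p]; this uniformity is
    what differentiation in the base point requires. *)
Lemma superpose_bound t0 f p : continuous f -> past t0 f ->
  exists (A : set Y) (M : R), [/\ measurable A, (mu A < +oo)%E &
    forall q y, `|q - p| <= 1 ->
      (~ A y -> f (q + gamma y) = 0) /\ `|w y * f (q + gamma y)| <= M].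
Proof.
(* The summand 1 allows for moving the base point by at most 1 in time. *)
move=> cf pf; have [A [rho [mA Afin AP]]] := gamma_proper (t0 - p.2 + 1).
have [M MP] := bounded_on_box (`|p| + 1 + rho) cf.
exists A, (`|W| * `|M|); split => // q y qp.
have W0 : `|w y| <= `|W| by exact: le_trans (wW y) (ler_norm _).
have [yb|yb] := leP (gamma y).2 (t0 - p.2 + 1); last first.
  have -> : f (q + gamma y) = 0.
    apply: pf => /=; move: qp; rewrite prod_norm_le => /andP[_].
    by rewrite ler_norml /= => /andP[qp _]; lra.
  by split => //; rewrite mulr0 normr0 mulr_ge0.
have [Ay g1 g2] := AP y yb; split => //.
rewrite normrM ler_pM//; apply: le_trans (ler_norm M).
have : `|q| <= `|p| + 1.
  by rewrite -[q](subrK p) addrC (le_trans (ler_normD _ _))// lerD2l.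
by rewrite prod_norm_le => /andP[q1 q2];
  apply: MP => /=; apply: le_trans (ler_normD _ _) _; rewrite lerD.
Qed.

Lemma superpose_integrable t0 f p : continuous f -> past t0 f ->
  mu.-integrable setT (EFin \o (fun y => w y * f (p + gamma y))).
Proof.
move=> cf pf; have [A [M [mA Afin AP]]] := superpose_bound p cf pf.
have p1 : `|p - p| <= 1 by rewrite subrr normr0.
apply: (integrable_bounded mA Afin (superpose_measurable p cf) (M := M)) => y.
  exact: (AP p y p1).2.
by move=> Ay; rewrite (AP p y p1).1// mulr0.
Qed.

Lemma coord_dir_norm (c : option 'I_m) : `|coord_dir c : V| <= 1.
Proof.
rewrite prod_norm_le; case: c => [i|] /=; last by rewrite normr0 normr1 ler01 lexx.
rewrite normr0 ler01 andbT; apply/rV_norm_le => // j.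
by rewrite mxE; case: (_ && _); rewrite ?normr1 ?normr0.
Qed.

Lemma is_derive_superpose t0 f c p : wave_source t0 f ->
  is_derive p (coord_dir c) (superpose f) (superpose (pderive c f) p).
Proof.
move=> /[dup] -[sf pf] /(wave_source_pderive c)[sdf pdf].
have cf := smooth_continuous sf; have cdf := smooth_continuous sdf.
have [A [M1 [mA Afin AP]]] := superpose_bound p cf pf.
have [B [M2 [_ _ BP]]] := superpose_bound p cdf pdf.
have near_p (h : R) : `|h - 0| < 1 -> `|p + h *: coord_dir c - p| <= 1.
  rewrite subr0 => h1; rewrite addrAC subrr add0r normrZ.
  by rewrite mulr_ile1// ?(ltW h1)// coord_dir_norm.
apply/is_derive_line.
have := @is_derive_integral _ _ Y mu A
  (fun h y => w y * f (p + h *: coord_dir c + gamma y))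
  (fun h y => w y * pderive c f (p + h *: coord_dir c + gamma y))
  0 1 (Num.max M1 M2) ltr01 mA Afin.
rewrite scale0r addr0; apply.
- by move=> h _; exact: superpose_measurable.
- move=> h y _; apply: (@is_deriveZ _ _ _ _ (w y)).
  have -> : (fun x : R => f (p + x *: coord_dir c + gamma y)) =
      (fun x => f (p + gamma y + x *: coord_dir c)).
    by apply/funext => x; rewrite addrAC.
  rewrite (addrAC p); apply: is_derive_lineT; exact: smooth_derivable.
- by move=> h y /near_p hp Ay; rewrite (AP _ _ hp).1// mulr0.
- by move=> h y /near_p hp; rewrite le_max (AP _ _ hp).2.
- by move=> h y /near_p hp; rewrite le_max (BP _ _ hp).2 orbT.
Qed.

Lemma pderive_superpose t0 f c : wave_source t0 f ->
  pderive c (superpose f) = superpose (pderive c f).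
Proof.
by move=> sf; apply/funext => p; case: (is_derive_superpose c p sf).
Qed.

Lemma foldr_pderive_superpose t0 f s : wave_source t0 f ->
  foldr pderive (superpose f) s = superpose (foldr pderive f s) /\
  wave_source t0 (foldr pderive f s).
Proof.
move=> sf; elim: s => //= c s [-> sfs]; split; first exact: pderive_superpose sfs.
exact: wave_source_pderive.
Qed.

Lemma superposeD t0 (a : R) f g p : wave_source t0 f -> wave_source t0 g ->
  superpose (fun q => f q + a * g q) p = superpose f p + a * superpose g p.
Proof.
move=> [sf pf] [sg pg].
have If := superpose_integrable p (smooth_continuous sf) pf.
have Ig := superpose_integrable p (smooth_continuous sg) pg.
rewrite /superpose -RintegralZl// -RintegralD//.
  by apply: eq_Rintegral => y _; ring.
rewrite (_ : _ \o _ = (fun x => a%:E * (EFin \o (fun y => (w y * g (p + gamma y))%R)) x)%E).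
  exact: integrableZl.
by apply/funext => y.
Qed.

Lemma superpose_sum t0 (I : Type) (s : seq I) (F : I -> V -> R) p :
    (forall i, wave_source t0 (F i)) ->
  superpose (fun q => \sum_(i <- s) F i q) p = \sum_(i <- s) superpose (F i) p.
Proof.
move=> sF; elim: s => [|i s IHs].
  under [in LHS]eq_fun do rewrite big_nil.
  rewrite big_nil /superpose; under eq_Rintegral do rewrite mulr0.
  by rewrite Rintegral_cst// mul0r.
under [in LHS]eq_fun do rewrite big_cons -[X in _ + X]mul1r.
rewrite (superposeD (t0 := t0))// ?big_cons ?IHs ?mul1r//.
split; first by apply: smooth_sum => j; case: (sF j).
by move=> q qt; rewrite big1// => j _; apply: (sF j).2.
Qed.

Lemma superpose_dAlembert t0 f : wave_source t0 f ->
  dAlembert (superpose f) = superpose (dAlembert f).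
Proof.
move=> sf; apply/funext => p; rewrite /dAlembert.
have s2 c : wave_source t0 (pderive c (pderive c f)).
  exact/wave_source_pderive/wave_source_pderive.
under [in RHS]eq_fun do rewrite -mulN1r.
rewrite (superposeD (t0 := t0))//; last first.
  split; first by apply: smooth_sum => j; case: (s2 (Some j)).
  by move=> q qt; rewrite big1// => j _; apply: (s2 (Some j)).2.
rewrite (superpose_sum _ _ (fun i => s2 (Some i))) mulN1r.
have E c : pderive c (pderive c (superpose f)) = superpose (pderive c (pderive c f)).
  rewrite (pderive_superpose _ sf) (pderive_superpose (t0 := t0))//.
  exact: wave_source_pderive.
by rewrite E; congr (_ - _); apply: eq_bigr => i _; rewrite E.
Qed.

Lemma superpose_iter_dAlembert t0 n f : wave_source t0 f ->
  iter n dAlembert (superpose f) = superpose (iter n dAlembert f).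
Proof.
move=> sf; elim: n => //= n ->; apply: (@superpose_dAlembert t0).
exact: wave_source_iter_dAlembert.
Qed.

Lemma superpose_continuous t0 f : continuous f -> past t0 f ->
  continuous (superpose f).
Proof.
move=> cf pf p.
have [A [rho [mA Afin AP]]] := gamma_proper (t0 - p.2 + 1).
pose K : set V := [set z | `|z| <= rho].
have cK : compact K by exact: compact_norm_le.
apply/cvgrPdist_le => e e0.
pose a : R := fine (mu A).
have a0 : 0 <= a by rewrite fine_ge0.
(* Chosen so that weight times [b] times the measure of [A] stays below [e]; the added ones exclude
   division by zero. *)
pose b := e / ((`|W| + 1) * (a + 1)).
have b0 : 0 < b by rewrite divr_gt0// mulr_gt0// ltr_wpDl.
have unif : \forall q \near p, K `<=` (fun z => `|f (p + z) - f (q + z)| < b).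
  (* Compactness of [K] turns pointwise continuity at [p + z] into an estimate uniform in [z]. *)
  move/compact_near_coveringP: cK => /(_ V (nbhs p)
    (fun q z => `|f (p + z) - f (q + z)| < b) _); apply => z Kz.
  have b20 : 0 < b / 2 by rewrite divr_gt0.
  have /cvgrPdist_lt/(_ _ b20)/nbhs_ballP[r /= r0 rP] := cf (p + z).
  have r20 : 0 < r / 2 by rewrite divr_gt0.
  exists (ball z (r / 2), ball p (r / 2)) => /=.
    by split; exact: nbhsx_ballx.
  move=> [z' q] /=; rewrite -!ball_normE /= => -[zz' pq].
  rewrite (splitr b) -(subrKA (f (p + z))).
  apply: (le_lt_trans (ler_normD _ _)); rewrite ltrD//.
    rewrite distrC; apply: rP; rewrite -ball_normE /= opprD addrACA subrr add0r.
    by apply: lt_trans zz' _; rewrite ltr_pdivrMr// ltr_pMr// ltr1n.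
  apply: rP; rewrite -ball_normE /= opprD addrACA (splitr r).
  by apply: (le_lt_trans (ler_normD _ _)); rewrite ltrD.
have near1 : \forall q \near p, `|p - q| < 1.
  by apply/nbhs_ballP; exists 1 => //= q; rewrite -ball_normE.
near=> q.
have qp : `|q - p| <= 1.
  by rewrite distrC; apply/ltW; exact: (near near1 q).
have If := superpose_integrable p cf pf.
have Ig := superpose_integrable q cf pf.
pose G := (fun _ : Y => `|W| * b) \_ A.
have G0 y : 0 <= G y by rewrite /G patchE; case: ifP => // _; rewrite mulr_ge0// ltW.
have IG : mu.-integrable setT (EFin \o G).
  apply: (integrable_bounded mA Afin _ (M := `|W| * b)) => [|y|y Ay].
  - apply/(measurable_restrictT _ mA); exact: measurable_cst.
  - rewrite ger0_norm// /G patchE; case: ifP => // _; exact: mulr_ge0 (ltW b0).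
  - by rewrite /G patchE memNset.
rewrite /superpose -RintegralB//.
have ID : mu.-integrable setT (EFin \o (fun y =>
    w y * f (p + gamma y) - w y * f (q + gamma y))).
  by have := integrableB measurableT If Ig; congr (mu.-integrable _ _).
apply: (le_trans (le_normr_Rintegral measurableT ID)).
apply: (@le_trans _ _ (\int[mu]_y G y)).
  apply: le_Rintegral => //; first exact: integrable_norm.
  move=> y _; rewrite -mulrBr normrM.
  have [yb|yb] := leP (gamma y).2 (t0 - p.2 + 1).
    have [Ay g1 g2] := AP y yb.
    rewrite /G patchE mem_set//; apply: ler_pM => //.
      exact: le_trans (wW y) (ler_norm _).
    apply/ltW; have : K (gamma y) by rewrite /K /= prod_norm_le g1 g2.
    by move: (gamma y); near: q.
  move: qp; rewrite prod_norm_le => /andP[_]; rewrite ler_norml /= => /andP[qp _].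
  rewrite !pf /=; first by rewrite subrr normr0 mulr0.
    by lra.
  by lra.
rewrite /G -Rintegral_mkcond Rintegral_cst// -/a /b.
rewrite mulrAC mulrA ler_pdivrMr; last by rewrite mulr_gt0// ltr_wpDl.
rewrite mulrC ler_pM2l//.
by apply: ler_pM => //; rewrite lerDl.
Unshelve. all: by end_near. Qed.

Lemma smooth_superpose t0 f : wave_source t0 f -> smooth (superpose f).
Proof.
move=> wf s; have [-> ws] := foldr_pderive_superpose s wf.
split; first exact: superpose_continuous (smooth_continuous ws.1) ws.2.
by move=> c p; case: (is_derive_superpose c p ws).
Qed.

End Superpose.

Lemma continuous_sum (R : realType) (X : topologicalType) (I : Type) (r : seq I)
    (f : I -> X -> R) :
  (forall i, continuous (f i)) -> continuous (fun x => \sum_(i <- r) f i x).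
Proof. by move=> cf x; apply: (cvg_big add_continuous) => i _; exact: cf. Qed.

(** * Integrals over hyperboloids *)

Section Hyperboloid.
Context {R : realType} {m : nat}.
Local Notation T := (measurableTypeR R).
Local Notation V := (spacetime R m).
Local Notation lambda := (lebesgue_tuple m).
Implicit Types (f psi : V -> R) (p : V) (v : 'rV[R]_m) (s : R).

(* The hyperboloid [t = hrad s v], [s > 0], has no vertex singularity; the cone is
   its limit at [s = 0]. *)
Definition hrad s v : R := Num.sqrt (\sum_(i < m) v 0 i ^+ 2 + s).

Definition hyperboloid s (u : m.-tuple T) : V :=
  (row_of_tuple u, hrad s (row_of_tuple u)).

Lemma sqnorm_ge0 v : 0 <= \sum_(i < m) v 0 i ^+ 2.
Proof. by apply: sumr_ge0 => i _; exact: sqr_ge0. Qed.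

Lemma hrad_ge0 s v : 0 <= hrad s v. Proof. exact: sqrtr_ge0. Qed.

Lemma hrad_gt0 s v : 0 < s -> 0 < hrad s v.
Proof. by move=> s0; rewrite sqrtr_gt0 ltr_wpDl// sqnorm_ge0. Qed.

Lemma sqr_hrad s v : 0 <= s -> hrad s v ^+ 2 = \sum_(i < m) v 0 i ^+ 2 + s.
Proof. by move=> s0; rewrite sqr_sqrtr// addr_ge0// sqnorm_ge0. Qed.

Lemma norm_le_hrad s v : 0 <= s -> `|v| <= hrad s v.
Proof.
move=> s0; apply/rV_norm_le => [|i]; first exact: hrad_ge0.
rewrite -sqrtr_sqr ler_wsqrtr// (bigD1 i)//= -addrA lerDl addr_ge0//.
by apply: sumr_ge0 => j _; exact: sqr_ge0.
Qed.

Lemma sqnorm_continuous : continuous (fun v : 'rV[R]_m => \sum_(i < m) v 0 i ^+ 2).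
Proof.
apply: continuous_sum => i v.
exact: (continuous_comp (@coord_continuous R 1 m 0 i v) (@exprn_continuous R 2 _)).
Qed.

Lemma hrad_continuous s : continuous (hrad s).
Proof.
have add_s : continuous (fun x : R => x + s).
  by move=> x; apply: cvgD; [exact: cvg_id|exact: cvg_cst].
move=> v; apply: (continuous_comp (@sqnorm_continuous v)
  (g := (@Num.sqrt R \o (fun x => x + s)))).
by apply: continuous_comp; [exact: add_s|exact: sqrt_continuous].
Qed.

Lemma hyperboloid_continuous f s : continuous f ->
  continuous (fun v => f (v, hrad s v)).
Proof.
move=> cf v; apply: (@cvg_comp _ _ _ (fun v => (v, hrad s v)) f); last exact: cf.
exact: (cvg_pair (@cvg_id _ (nbhs v)) (@hrad_continuous s v)).
Qed.

Lemma measurable_hyperboloid s f : continuous f ->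
  measurable_fun setT (fun u => f (hyperboloid s u)).
Proof.
move=> cf; apply: (measurable_row_continuous (F := fun v => f (v, hrad s v))).
exact: hyperboloid_continuous.
Qed.

Lemma hyperboloid_proper s : 0 <= s -> forall b : R,
  exists (A : set (m.-tuple T)) (rho : R), [/\ measurable A, (lambda A < +oo)%E &
    forall u, (hyperboloid s u).2 <= b ->
    [/\ A u, `|(hyperboloid s u).1| <= rho & `|(hyperboloid s u).2| <= rho]].
Proof.
move=> s0 b; exists (box b), b; split; [exact: measurable_box|exact: lebesgue_box_lty|].
move=> u /= ub.
have vb : `|row_of_tuple u| <= b by exact: le_trans (norm_le_hrad _ s0) ub.
by split => //; rewrite ger0_norm// hrad_ge0.
Qed.

Definition radw l s (u : m.-tuple T) : R := (hrad s (row_of_tuple u))^-1 ^+ l.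

Lemma radV_continuous s : 0 < s -> continuous (fun v => (hrad s v)^-1).
Proof.
by move=> s0 v; exact: (cvgV (lt0r_neq0 (hrad_gt0 v s0)) (@hrad_continuous s v)).
Qed.

Lemma measurable_radw l s : 0 < s -> measurable_fun setT (radw l s).
Proof.
move=> s0; apply: (measurable_row_continuous (F := fun v => (hrad s v)^-1 ^+ l)) => v.
exact: (continuous_comp (radV_continuous s0 (x:=v)) (@exprn_continuous _ l _)).
Qed.

Lemma radV_le s v : 0 < s -> (hrad s v)^-1 <= (Num.sqrt s)^-1.
Proof.
move=> s0; rewrite lef_pV2 ?posrE ?hrad_gt0 ?sqrtr_gt0//.
by rewrite ler_wsqrtr// lerDr sqnorm_ge0.
Qed.

Lemma radw_le l s u : 0 < s -> `|radw l s u| <= (Num.sqrt s)^-1 ^+ l.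
Proof.
move=> s0; rewrite /radw ger0_norm ?exprn_ge0 ?invr_ge0 ?hrad_ge0//.
by apply: lerXn2r; rewrite ?nnegrE ?invr_ge0 ?sqrtr_ge0 ?hrad_ge0//; exact: radV_le.
Qed.

Definition hint l psi p s : R := superpose lambda (hyperboloid s) (radw l s) psi p.

Lemma hint_integrable l t0 psi p s : 0 < s -> wave_source t0 psi ->
  lambda.-integrable setT (EFin \o (fun u => radw l s u * psi (p + hyperboloid s u))).
Proof.
move=> s0 [sf pf].
have := superpose_integrable (measurable_hyperboloid s) (hyperboloid_proper (ltW s0))
  (measurable_radw l s0) (fun u => radw_le l u s0) p (smooth_continuous sf) pf; exact.
Qed.

Lemma is_derive_hrad v s : 0 < s -> is_derive s 1 (hrad ^~ v) ((2 * hrad s v)^-1).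
Proof.
move=> s0; rewrite -[(2 * _)^-1]mulr1.
have := @is_derive1_comp _ (@Num.sqrt R) (fun s => \sum_(i < m) v 0 i ^+ 2 + s) s.
apply; first by apply: is_derive1_sqrt; rewrite ltr_wpDl// sqnorm_ge0.
by rewrite -[X in is_derive _ _ _ X]add0r; apply: is_deriveD.
Qed.

Lemma is_derive_hradVX l v s : 0 < s -> is_derive s 1 (fun s => (hrad s v)^-1 ^+ l)
  (- (l%:R / 2) * (hrad s v)^-1 ^+ l.+2).
Proof.
move=> s0; have r0 := hrad_gt0 v s0.
have dV : is_derive s 1 (fun s => (hrad s v)^-1) (- (hrad s v)^-2 * (2 * hrad s v)^-1).
  have [fd fE] := is_derive_hrad v s0; apply: DeriveDef.
    by apply: derivableV => //; rewrite gt_eqF.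
  by rewrite deriveV ?gt_eqF// fE.
have dX (x : R) : is_derive x 1 (fun x : R => x ^+ l) (l%:R * x ^+ l.-1).
  apply: DeriveDef; first exact: exprn_derivable.
  by rewrite exp_derive [_ *: _]mulr1 -mulr_natl.
apply: is_derive_eq (is_derive1_comp (dX _) dV) _.
case: l {dX} => [|l]; first by rewrite !mul0r oppr0 mul0r.
rewrite /= -!exprVn !exprS; field; by rewrite gt_eqF.
Qed.

Lemma is_derive_time psi p v s : smooth psi -> 0 < s ->
  is_derive s 1 (fun s => psi (p + (v, hrad s v)))
    (2^-1 * ((hrad s v)^-1 * pderive None psi (p + (v, hrad s v)))).
Proof.
move=> sf s0.
have E (x : R) : p + (v, x) = p + (v, 0) + x *: coord_dir None :> V.
  by rewrite -addrA; congr (_ + _); congr pair => /=; rewrite ?scaler0 ?addr0// add0r [_ *: _]mulr1.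
have := @is_derive1_comp _ (fun x => psi (p + (v, 0) + x *: coord_dir None)) (hrad^~ v) s.
move=> /(_ _ _ (is_derive_lineT _) (is_derive_hrad v s0)).
rewrite -E => /(_ (smooth_derivable sf)) H.
have -> : (fun s => psi (p + (v, hrad s v))) =
  (fun x => psi (p + (v, 0) + x *: coord_dir None)) \o (hrad^~ v).
  by apply/funext => x /=; rewrite E.
by apply: is_derive_eq H _; rewrite /pderive invfM; ring.
Qed.

(** Since [dr/ds = 1/(2r)], the derivative produces one term from the time argument of [psi] and one
    from the weight [r^-l]; the class of integrals [hint] is closed under it. *)
Lemma is_derive_hint l t0 psi p s : wave_source t0 psi -> 0 < s ->
  is_derive s 1 (hint l psi p)
    (2^-1 * hint l.+1 (pderive None psi) p s - l%:R / 2 * hint l.+2 psi p s).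
Proof.
move=> ws s0; have wt := wave_source_pderive None ws.
have [sf pf] := ws; have [st pt] := wt.
pose F' s u := 2^-1 * (radw l.+1 s u * pderive None psi (p + hyperboloid s u))
  - l%:R / 2 * (radw l.+2 s u * psi (p + hyperboloid s u)).
have -> : 2^-1 * hint l.+1 (pderive None psi) p s - l%:R / 2 * hint l.+2 psi p s =
    \int[lambda]_u F' s u.
  rewrite /hint /superpose -!RintegralZl//; [|exact: hint_integrable ws|exact: hint_integrable wt].
  rewrite -RintegralB//.
    exact: (integrableZl measurableT _ (hint_integrable l.+1 p s0 wt)).
  exact: (integrableZl measurableT _ (hint_integrable l.+2 p s0 ws)).
(* Within distance [s / 2] of [s] the parameter exceeds [s / 2], which bounds the negative powers of
   the radius uniformly. *)
have s20 : 0 < s / 2 by rewrite divr_gt0.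
pose b := Num.max 0 (t0 - p.2).
have [M1 M1P] := bounded_on_box (`|p| + b) (smooth_continuous sf).
have [M2 M2P] := bounded_on_box (`|p| + b) (smooth_continuous st).
have b0 : 0 <= b by rewrite le_max lexx.
have pb : 0 <= `|p| + b by rewrite addr_ge0.
have near_s x : `|x - s| < s / 2 -> s / 2 < x by rewrite ltr_norml => /andP[]; lra.
have zero f x u : past t0 f -> 0 < x -> ~ box b u -> f (p + hyperboloid x u) = 0.
  move=> pf' x0 ub; apply: pf' => /=; rewrite ltNge; apply/negP => h; apply: ub.
  rewrite /box /=; apply: (le_trans (norm_le_hrad _ (ltW x0))).
  by rewrite le_max; apply/orP; right; rewrite lerBrDl.
have bnd f M x u : (forall p0 : V, `|p0.1| <= `|p| + b -> `|p0.2| <= `|p| + b -> `|f p0| <= M) ->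
    past t0 f -> 0 < x -> `|f (p + hyperboloid x u)| <= M.
  move=> fM pf' x0; have M0 : 0 <= M.
    by apply: le_trans (fM 0 _ _); rewrite ?normr0.
  have [h|h] := leP (hrad x (row_of_tuple u)) b.
    have : `|p| <= `|p| by [].
    rewrite {1}prod_norm_le => /andP[p1 p2].
    apply: fM; apply: (le_trans (ler_normD _ _)); apply: lerD => //=.
      exact: le_trans (norm_le_hrad _ (ltW x0)) h.
    by rewrite ger0_norm// hrad_ge0.
  rewrite pf' ?normr0//=; move: h; rewrite gt_max => /andP[_].
  by rewrite ltrBlDl.
pose c n : R := (Num.sqrt (s / 2))^-1 ^+ n.
have radw_c n x u : s / 2 < x -> `|radw n x u| <= c n.
  move=> sx; apply: (le_trans (radw_le n u (lt_trans s20 sx))).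
  apply: lerXn2r; rewrite ?nnegrE ?invr_ge0 ?sqrtr_ge0//.
  by rewrite lef_pV2 ?posrE ?sqrtr_gt0 ?(lt_trans s20 sx)// ler_wsqrtr// ltW.
have c0 n : 0 <= c n by rewrite exprn_ge0// invr_ge0 sqrtr_ge0.
have M10 : 0 <= M1 by apply: le_trans (M1P 0 _ _); rewrite ?normr0.
have M20 : 0 <= M2 by apply: le_trans (M2P 0 _ _); rewrite ?normr0.
have l20 : 0 <= l%:R / 2 :> R by rewrite divr_ge0// ler0n.
have bw f M n x u : (forall p0 : V, `|p0.1| <= `|p| + b -> `|p0.2| <= `|p| + b -> `|f p0| <= M) ->
    past t0 f -> s / 2 < x -> `|radw n x u * f (p + hyperboloid x u)| <= c n * M.
  move=> fM pf' sx; rewrite normrM; apply: ler_pM => //; first exact: radw_c.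
  exact: bnd fM pf' (lt_trans s20 sx).
apply: (@is_derive_integral _ _ _ lambda (box b)
  (fun s u => radw l s u * psi (p + hyperboloid s u)) F' s (s / 2)
  (c l * M1 + 2^-1 * (c l.+1 * M2) + l%:R / 2 * (c l.+2 * M1)) s20).
- exact: measurable_box.
- exact: lebesgue_box_lty.
- move=> x /near_s sx; have x0 := lt_trans s20 sx.
  exact: (superpose_measurable (measurable_hyperboloid x)
    (measurable_radw l x0) p (smooth_continuous sf)).
- move=> x u /near_s sx; have x0 := lt_trans s20 sx.
  have := is_deriveM (is_derive_hradVX l (row_of_tuple u) x0)
    (is_derive_time p (row_of_tuple u) sf x0).
  move=> H; apply: is_derive_eq H _.
  have ab (a1 b1 : R) : a1 *: (b1 : R^o) = a1 * b1 by [].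
  rewrite !ab /F' /radw /hyperboloid !exprS; ring.
- by move=> x u /near_s sx ub; rewrite (zero psi) ?mulr0//; exact: lt_trans sx.
- move=> x u /near_s sx; have x0 := lt_trans s20 sx.
  apply: (le_trans (bw psi M1 l x u M1P pf sx)); rewrite -addrA lerDl.
  by apply: addr_ge0; apply: mulr_ge0 => //; apply: mulr_ge0.
- move=> x u /near_s sx; have x0 := lt_trans s20 sx.
  rewrite /F'; apply: (le_trans (ler_normB _ _)).
  rewrite (normrM 2^-1) (normrM (l%:R / 2)) (ger0_norm (x := 2^-1))//.
  rewrite (ger0_norm l20); apply: lerD.
    apply: ler_wpDl; first exact: mulr_ge0.
    by rewrite ler_wpM2l//; exact: bw.
  by rewrite ler_wpM2l//; exact: bw.
Qed.

End Hyperboloid.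

Lemma continuous_mul (R : realType) (X : topologicalType) (f g : X -> R) :
  continuous f -> continuous g -> continuous (fun x => f x * g x).
Proof. by move=> cf cg x; apply: cvgM; [exact: cf|exact: cg]. Qed.

Lemma continuous_add (R : realType) (X : topologicalType) (f g : X -> R) :
  continuous f -> continuous g -> continuous (fun x => f x + g x).
Proof. by move=> cf cg x; apply: cvgD; [exact: cf|exact: cg]. Qed.

Lemma continuous_opp (R : realType) (X : topologicalType) (f : X -> R) :
  continuous f -> continuous (fun x => - f x).
Proof. by move=> cf x; apply: cvgN; exact: cf. Qed.

Lemma continuous_addr (R : realType) (U : normedModType R) (c : U) :
  continuous (fun x => x + c).
Proof. by move=> x; apply: cvgD; [exact: cvg_id|exact: cvg_cst]. Qed.

(** The identities in [s] below hold only for positive [s]; this is how they are differentiated. *)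
Lemma is_derive_unique_pos (R : realType) (f g : R -> R) (s a b : R) : 0 < s ->
    (forall x, 0 < x -> f x = g x) ->
  is_derive s 1 f a -> is_derive s 1 g b -> a = b.
Proof.
move=> s0 fg [_ <-] [_ <-]; apply: near_eq_derive.
have := @open_gt R 0; rewrite openE => /(_ s s0); apply: filterS => x.
exact: fg.
Qed.

(** * Integration by parts over [R^m] *)

Section IntegrationByParts.
Context {R : realType} {m : nat}.
Local Notation T := (measurableTypeR R).
Local Notation V := (spacetime R m).
Local Notation lambda := (lebesgue_tuple m).

Lemma bounded_vanishing (G : 'rV[R]_m -> R) (rho : R) :
    continuous G -> (forall v, rho < `|v| -> G v = 0) ->
  exists2 M, 0 <= M & forall v, `|G v| <= M.
Proof.
move=> cG G0.
have cG1 : continuous (fun p : V => G p.1).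
  by move=> p; apply: (@cvg_comp _ _ _ fst G); [exact: cvg_fst|exact: cG].
have [M MP] := bounded_on_box `|rho| cG1.
have M0 : 0 <= M by apply: le_trans (MP 0 _ _); rewrite ?normr0.
exists M => // v; have [h|h] := leP `|v| `|rho|.
  by apply: (MP (v, 0)) => //=; rewrite normr0.
by rewrite G0 ?normr0//; apply: le_lt_trans h; exact: ler_norm.
Qed.

Lemma vanishing_integrable (G : 'rV[R]_m -> R) (rho : R) :
    continuous G -> (forall v, rho < `|v| -> G v = 0) ->
  lambda.-integrable setT (EFin \o (fun u => G (row_of_tuple u))).
Proof.
move=> cG G0; have [M M0 MP] := bounded_vanishing cG G0.
have := @integrable_bounded _ _ _ lambda (box rho) (fun u => G (row_of_tuple u)) M
  (measurable_box rho) (lebesgue_box_lty m rho); apply => [|u|u ub].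
- exact: measurable_row_continuous.
- exact: MP.
- by apply: G0; rewrite ltNge; exact/negP.
Qed.

(* The integral of [G (v + h e_i)] does not depend on [h]. *)
Lemma integral_derive_row (G G' : 'rV[R]_m -> R) (i : 'I_m) (rho : R) :
    continuous G -> continuous G' ->
    (forall v, is_derive v (delta_mx 0 i) G (G' v)) ->
    (forall v, rho < `|v| -> G v = 0) -> (forall v, rho < `|v| -> G' v = 0) ->
  \int[lambda]_u G' (row_of_tuple u) = 0.
Proof.
move=> cG cG' dG G0 G'0.
have [M M0 MP] := bounded_vanishing cG G0.
have [M' M'0 M'P] := bounded_vanishing cG' G'0.
pose e : 'rV[R]_m := delta_mx 0 i.
have e1 : `|e| <= 1.
  apply/rV_norm_le => // j; rewrite mxE.
  by case: (_ && _); rewrite ?normr1 ?normr0.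
have cGh (h : R) : continuous (fun v : 'rV[R]_m => G (v + h *: e)).
  by move=> v; exact: (continuous_comp (@continuous_addr _ _ (h *: e) v) (cG _)).
have := @is_derive_integral _ _ _ lambda (box (rho + 1))
  (fun (h : R) u => G (row_of_tuple u + h *: e))
  (fun (h : R) u => G' (row_of_tuple u + h *: e)) 0 1 (M + M') ltr01
  (measurable_box _) (lebesgue_box_lty _ _).
have -> : (fun h : R => \int[lambda]_u G (row_of_tuple u + h *: e)) =
    fun _ => \int[lambda]_u G (row_of_tuple u).
  apply/funext => h.
  have := Rintegral_row_affine (h *: e) ltr01 (vanishing_integrable cG G0).
  rewrite invr1 expr1n mul1r => <-.
  by apply: eq_Rintegral => u _; rewrite scale1r.
move=> H.
have {}H : is_derive (0 : R) 1 (fun _ : R => \int[lambda]_u G (row_of_tuple u))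
    (\int[lambda]_u G' (row_of_tuple u + (0 : R) *: e)).
  apply: H.
  - move=> h _; exact: measurable_row_continuous (cGh h).
  - move=> h u _; have [dGv GE] := dG (row_of_tuple u + h *: e).
    by rewrite -GE; exact: is_derive_lineT.
  - move=> h u; rewrite subr0 => h1 ub; apply: G0; rewrite ltNge; apply/negP => hr.
    apply: ub; rewrite /box /=.
    rewrite -[row_of_tuple u](addrK (h *: e)); apply: (le_trans (ler_normB _ _)).
    apply: lerD => //; rewrite normrZ mulr_ile1// ltW//.
  - by move=> h u _; apply: (le_trans (MP _)); rewrite lerDl.
  - by move=> h u _; apply: (le_trans (M'P _)); rewrite lerDr.
have [_ <-] := is_derive_cst (\int[lambda]_u G (row_of_tuple u) : R^o) (0 : R^o) (1 : R^o).
case: H => _ ->.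
by apply: eq_Rintegral => u _; rewrite scale0r addr0.
Qed.

Lemma Rintegral_sum d (Y : measurableType d) (mu : {measure set Y -> \bar R})
    (I : Type) (r : seq I) (F : I -> Y -> R) :
    (forall i, mu.-integrable setT (EFin \o F i)) ->
  mu.-integrable setT (EFin \o (fun y => \sum_(i <- r) F i y)) /\
  \int[mu]_y (\sum_(i <- r) F i y) = \sum_(i <- r) \int[mu]_y F i y.
Proof.
move=> IF; elim: r => [|i r [IHi IHr]].
  rewrite big_nil; split.
    rewrite (_ : _ \o _ = cst 0%E); first exact: integrable0.
    by apply/funext => y /=; rewrite big_nil.
  by under eq_Rintegral do rewrite big_nil; rewrite Rintegral_cst// mul0r.
have E : (fun y => \sum_(i <- i :: r) F i y) = (fun y => F i y + \sum_(i <- r) F i y).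
  by apply/funext => y; rewrite big_cons.
rewrite E; split; last by rewrite RintegralD// big_cons IHr.
by have := integrableD measurableT (IF i) IHi; congr (mu.-integrable _ _).
Qed.

End IntegrationByParts.

(** * The d'Alembertian under the hyperboloid integral *)

Section WaveIdentity.
Context {R : realType} {m : nat}.
Local Notation T := (measurableTypeR R).
Local Notation V := (spacetime R m).
Local Notation lambda := (lebesgue_tuple m).
Implicit Types (f psi phi : V -> R) (p : V) (v : 'rV[R]_m) (s : R) (i : 'I_m).

Lemma sqnorm_line v i (h : R) :
  \sum_(j < m) (v + h *: delta_mx 0 i) 0 j ^+ 2 =
  \sum_(j < m) v 0 j ^+ 2 + (h * v 0 i *+ 2 + h ^+ 2).
Proof.
rewrite (bigD1 i)//= [in RHS](bigD1 i)//= [X in _ + X = _](_ : _ = \sum_(j < m | j != i) v 0 j ^+ 2).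
  by rewrite !mxE !eqxx /=; ring.
by apply: eq_bigr => j ji; rewrite !mxE eqxx (negbTE ji) mulr0 addr0.
Qed.

Lemma is_derive_hrad_row s v i : 0 < s ->
  is_derive v (delta_mx 0 i) (hrad s) (v 0 i * (hrad s v)^-1).
Proof.
move=> s0; apply/is_derive_line; rewrite /hrad.
under eq_fun do rewrite sqnorm_line.
pose q (h : R) : R := \sum_(j < m) v 0 j ^+ 2 + (h * v 0 i *+ 2 + h ^+ 2) + s.
have dq : is_derive (0 : R) 1 q (v 0 i *+ 2).
  have -> : q = horner ((\sum_(j < m) v 0 j ^+ 2 + s)%:P + (v 0 i *+ 2) *: 'X + 'X^2).
    by apply/funext => h; rewrite !hornerE /q; ring.
  apply: DeriveDef; first exact: derivable_horner.
  rewrite -derive1E -derivE !(derivD, derivC, derivZ, derivX, derivXn) !hornerE.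
  by change (v 0 i *+ 2 + 0 + 0 = v 0 i *+ 2); rewrite !addr0.
have q0 : q 0 = \sum_(j < m) v 0 j ^+ 2 + s by rewrite /q; ring.
have dsq : is_derive (q 0) 1 (@Num.sqrt R) ((2 * Num.sqrt (q 0))^-1).
  by apply: is_derive1_sqrt; rewrite q0 ltr_wpDl// sqnorm_ge0.
apply: is_derive_eq (is_derive1_comp dsq dq) _.
have r0 := hrad_gt0 v s0; rewrite q0 -/(hrad s v) -mulr_natl.
by field; rewrite gt_eqF.
Qed.

Lemma is_derive_space psi p s v i : smooth psi -> 0 < s ->
  is_derive v (delta_mx 0 i) (fun v => psi (p + (v, hrad s v)))
    (pderive (Some i) psi (p + (v, hrad s v)) +
     v 0 i * (hrad s v)^-1 * pderive None psi (p + (v, hrad s v))).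
Proof.
move=> sf s0; apply/is_derive_line.
have E h : p + (v + h *: delta_mx 0 i, hrad s (v + h *: delta_mx 0 i)) =
    p + (v, 0) + h *: coord_dir (Some i) +
    hrad s (v + h *: delta_mx 0 i) *: coord_dir None :> V.
  rewrite -!addrA; congr (_ + _); congr pair => /=.
    by rewrite scaler0 addr0.
  by rewrite [h *: 0]mulr0 !add0r [RHS]mulr1.
under eq_fun do rewrite E.
have E0 : p + (v, hrad s v) = p + (v, 0) + (0 : R) *: coord_dir (Some i) +
    hrad s (v + (0 : R) *: delta_mx 0 i) *: coord_dir None.
  by rewrite -E scale0r addr0.
rewrite E0 /pderive.
apply: (@is_derive_curve R _ psi (p + (v, 0)) (coord_dir (Some i))
  (coord_dir None) (fun h => hrad s (v + h *: delta_mx 0 i))).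
- by move=> q; exact: smooth_derivable.
- by apply: smooth_continuous; exact: (smooth_pderive (Some i) sf).
- by move=> q; exact: smooth_derivable.
- by apply/is_derive_line; exact: is_derive_hrad_row.
Qed.

Lemma hrad_vanish t0 psi p s v : past t0 psi -> 0 < s -> t0 - p.2 < `|v| ->
  psi (p + (v, hrad s v)) = 0.
Proof.
move=> pf s0 vt; apply: pf => /=; rewrite -ltrBlDl.
by apply: lt_le_trans vt _; apply: norm_le_hrad; exact: ltW.
Qed.

Lemma shifted_hyperboloid_continuous psi p s : continuous psi ->
  continuous (fun v => psi (p + (v, hrad s v))).
Proof.
by move=> cf; apply: (hyperboloid_continuous (f := fun q => psi (p + q)));
  exact: translate_continuous.
Qed.

(* [J] is the [i]-th partial derivative of
   [- (d_i phi) + (v_i / r) d_t phi] taken along the hyperboloid [r = hrad s v]. *)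
Lemma divergence_identity t0 phi p s i : wave_source t0 phi -> 0 < s ->
  let J v := - pderive (Some i) (pderive (Some i) phi) (p + (v, hrad s v)) +
     ((hrad s v)^-1 - v 0 i * v 0 i * ((hrad s v)^-1 * ((hrad s v)^-1 * (hrad s v)^-1)))
       * pderive None phi (p + (v, hrad s v)) +
     v 0 i * v 0 i * ((hrad s v)^-1 * (hrad s v)^-1)
       * pderive None (pderive None phi) (p + (v, hrad s v)) in
  lambda.-integrable setT (fun u => (J (row_of_tuple u))%:E) /\
  \int[lambda]_u J (row_of_tuple u) = 0.
Proof.
move=> ws s0 J.
have cpsi c f : wave_source t0 f ->
    continuous (fun v => pderive c f (p + (v, hrad s v))).
  by move=> [sf _]; apply: shifted_hyperboloid_continuous;
    exact/smooth_continuous/smooth_pderive.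
have ci : continuous (fun v : 'rV[R]_m => v 0 i) by exact: coord_continuous.
have cr := radV_continuous (m := m) s0.
have wt := wave_source_pderive None ws.
have wi := wave_source_pderive (Some i) ws.
have cJ : continuous J.
  apply: continuous_add; first apply: continuous_add.
  - exact/continuous_opp/(cpsi _ _ wi).
  - apply: continuous_mul; last exact: cpsi.
    apply: continuous_add => //; apply: continuous_opp.
    by apply: continuous_mul; apply: continuous_mul => //; exact: continuous_mul.
  - apply: continuous_mul; last exact: cpsi.
    by apply: continuous_mul; exact: continuous_mul.
have van c f v : wave_source t0 f -> t0 - p.2 < `|v| ->
    pderive c f (p + (v, hrad s v)) = 0.
  move=> [_ pf] vt; apply: hrad_vanish s0 vt; exact: past_pderive pf.
have J0 v : t0 - p.2 < `|v| -> J v = 0.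
  by move=> vt; rewrite /J !van// !mulr0 oppr0 !addr0.
split; first exact: vanishing_integrable cJ J0.
pose G v := - pderive (Some i) phi (p + (v, hrad s v)) +
  v 0 i * (hrad s v)^-1 * pderive None phi (p + (v, hrad s v)).
apply: (@integral_derive_row _ _ G J i (t0 - p.2)) => //.
- apply: continuous_add; first exact/continuous_opp/cpsi.
  by apply: continuous_mul; [exact: continuous_mul|exact: cpsi].
- move=> v.
  have d1 := is_derive_space p v i wi.1 s0.
  have d2 := is_derive_space p v i wt.1 s0.
  have d3 := is_derive_hrad_row v i s0.
  have d4 : is_derive v (delta_mx 0 i) (fun v => (hrad s v)^-1)
      (- (hrad s v)^-2 * (v 0 i * (hrad s v)^-1)).
    have [fd fE] := d3; have r0 := lt0r_neq0 (hrad_gt0 v s0).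
    by apply: DeriveDef; [exact: derivableV|rewrite deriveV// fE].
  have d5 : is_derive v (delta_mx 0 i) (fun v : 'rV[R]_m => v 0 i) 1.
    apply/is_derive_line.
    have -> : (fun h : R => (v + h *: delta_mx 0 i) 0 i) = (fun h => v 0 i + h).
      by apply/funext => h; rewrite !mxE !eqxx mulr1.
    have := is_deriveD (is_derive_cst (v 0 i : R^o) (0 : R^o) (1 : R^o)) (is_derive_id (0 : R^o) (1 : R^o)).
    by move=> H; apply: is_derive_eq H _; rewrite add0r.
  have ab (a1 b1 : R) : a1 *: (b1 : R^o) = a1 * b1 by [].
  have d6 : is_derive v (delta_mx 0 i) (fun v => v 0 i * (hrad s v)^-1)
      ((hrad s v)^-1 - v 0 i * v 0 i * ((hrad s v)^-1 * ((hrad s v)^-1 * (hrad s v)^-1))).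
    by apply: is_derive_eq (is_deriveM d5 d4) _; rewrite !ab -exprVn; ring.
  have d7 := is_deriveD (is_deriveN d1) (is_deriveM d6 d2).
  (* The mixed derivatives of [phi] in [x_i] and [t] arising from the two terms of [G] cancel; the
     signs and the factor [v_i / r] in [G] are chosen for this. *)
  apply: is_derive_eq d7 _; rewrite /J (pderiveC (Some i) None ws.1).
  move: (pderive None (pderive (Some i) phi) _) => a1.
  move: (pderive None (pderive None phi) _) => a2.
  move: (pderive None phi _) => a3.
  move: (pderive (Some i) (pderive (Some i) phi) _) => a4.
  move: (hrad s v)^-1 (v 0 i) => r x.
  rewrite 2!ab; ring.
- by move=> v vt; rewrite /G !van// mulr0 oppr0 addr0.
Qed.

(** Summing the divergence identities over [i] and substituting [|v|^2 = r^2 - s] completes the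
    negative Laplacian to the d'Alembertian, with only time derivatives of [phi] left over. *)
Lemma hint_dAlembert t0 phi p s : wave_source t0 phi -> 0 < s ->
  hint 0 (dAlembert phi) p s =
  s * hint 2 (pderive None (pderive None phi)) p s -
  s * hint 3 (pderive None phi) p s + (1 - m%:R) * hint 1 (pderive None phi) p s.
Proof.
move=> ws s0.
have wt := wave_source_pderive None ws.
have wtt := wave_source_pderive None wt.
have wd : wave_source t0 (dAlembert phi) by exact: (wave_source_iter_dAlembert 1 ws).
have [_ ] := Rintegral_sum (index_enum 'I_m) (fun i => (divergence_identity p i ws s0).1).
rewrite [X in _ = X -> _]big1; last by move=> i _; exact: (divergence_identity p i ws s0).2.
have I l f : wave_source t0 f -> lambda.-integrable setT
    (EFin \o (fun u => radw l s u * f (p + hyperboloid s u))).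
  by move=> wf; exact: hint_integrable wf.
have IZ (c : R) l f : wave_source t0 f -> lambda.-integrable setT
    (EFin \o (fun u => c * (radw l s u * f (p + hyperboloid s u)))).
  by move=> wf; have := integrableZl measurableT c (I l f wf); congr (lambda.-integrable _ _).
rewrite /hint /superpose -!RintegralZl//; try exact: I.
move=> H; rewrite -RintegralB//; try exact: IZ.
rewrite -RintegralD//; try exact: IZ; last first.
  by have := integrableB measurableT (IZ s 2 _ wtt) (IZ s 3 _ wt); congr (lambda.-integrable _ _).
apply/eqP; rewrite -subr_eq0 -RintegralB//; try exact: I; last first.
  have := integrableD measurableT (integrableB measurableT (IZ s 2 _ wtt) (IZ s 3 _ wt)) (IZ (1 - m%:R) 1 _ wt).
  by congr (lambda.-integrable _ _).
rewrite -H; apply/eqP; apply: eq_Rintegral => u _.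
rewrite /radw /dAlembert /hyperboloid; set v := row_of_tuple u; set r := hrad s v.
have r0 : r != 0 by rewrite lt0r_neq0// hrad_gt0.
have S : \sum_(j < m) v 0 j * v 0 j = r ^+ 2 - s.
  by rewrite sqr_hrad ?ltW// addrK; apply: eq_bigr => j _; rewrite expr2.
rewrite !big_split /= sumrN -!mulr_suml big_split /= sumr_const card_ord sumrN -!mulr_suml S.
rewrite -mulr_natl; field; exact: r0.
Qed.

(* The [n]-th derivative in [s] of [hint l psi p], see [is_derive_hder]. *)
Fixpoint hder n l psi p s : R :=
  if n is n'.+1 then
    2^-1 * hder n' l.+1 (pderive None psi) p s - l%:R / 2 * hder n' l.+2 psi p s
  else hint l psi p s.

Lemma is_derive_hder t0 n l psi p s : wave_source t0 psi -> 0 < s ->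
  is_derive s 1 (hder n l psi p) (hder n.+1 l psi p s).
Proof.
move=> + s0; elim: n l psi => [|n IHn] l psi ws; first exact: is_derive_hint ws s0.
have d1 := IHn l.+1 _ (wave_source_pderive None ws).
have d2 := IHn l.+2 _ ws.
exact: (is_deriveB (is_deriveZ (2^-1 : R) d1) (is_deriveZ (l%:R / 2 : R) d2)).
Qed.

(* Differentiate [hint_dAlembert] [n] times in [s]. *)
Lemma hder_dAlembert t0 k n phi p s : m.+1 = (2 * k)%N ->
    wave_source t0 phi -> 0 < s ->
  hder n 0 (dAlembert phi) p s =
  4 * (s * hder n.+2 0 phi p s + (n%:R + 1 - k%:R) * hder n.+1 0 phi p s).
Proof.
move=> mk ws.
(* The parity of the dimension enters here: [1 - m] becomes [2 (1 - k)], and the right-hand side of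
   [hint_dAlembert] becomes a combination of the first two derivatives of [hint 0 phi p]. *)
have mkR : m%:R = 2 * k%:R - 1 :> R by rewrite -natrM -mk -natr1 addrK.
have wd : wave_source t0 (dAlembert phi) by exact: (wave_source_iter_dAlembert 1 ws).
elim: n s => [|n IHn] s s0.
  rewrite [LHS](hint_dAlembert p ws s0) mkR /=.
  move: (hint 1 _ p s) (hint 2 (pderive None (pderive None phi)) p s) => a1 a2.
  move: (hint 3 _ p s) (hint 4 phi p s) (hint 2 phi p s) => a3 a4 a5.
  by field.
have dR : is_derive s 1 (fun s => 4 * (s * hder n.+2 0 phi p s +
    (n%:R + 1 - k%:R) * hder n.+1 0 phi p s))
    (4 * (s * hder n.+3 0 phi p s + hder n.+2 0 phi p s +
      (n%:R + 1 - k%:R) * hder n.+2 0 phi p s)).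
  have d2 := is_derive_hder n.+2 0 p ws s0.
  have d1 := is_derive_hder n.+1 0 p ws s0.
  have dM := is_deriveM (is_derive_id s (1 : R^o)) d2.
  have := is_deriveZ (4 : R) (is_deriveD dM (is_deriveZ (n%:R + 1 - k%:R : R) d1)).
  by move=> H; apply: is_derive_eq H _; congr (4 * (_ + _)); congr (_ + _); rewrite [_ *: _]mulr1.
rewrite (is_derive_unique_pos s0 IHn (is_derive_hder n 0 p wd s0) dR).
by rewrite -[n.+1%:R]natr1; ring.
Qed.

(* For [j = k] the left-hand side is [hint 0 (iter k dAlembert phi) p s]. *)
Lemma hder_iter_dAlembert t0 k j phi p s : m.+1 = (2 * k)%N -> (j <= k)%N ->
    wave_source t0 phi -> 0 < s ->
  hder (k - j) 0 (iter j dAlembert phi) p s =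
  4 ^+ j * (s ^+ j * hder (k + j) 0 phi p s).
Proof.
move=> mk jk ws; elim: j jk s => [|j IHj] jk s s0.
  by rewrite subn0 addn0 !expr0 !mul1r.
have wj := wave_source_iter_dAlembert j ws.
rewrite iterS (hder_dAlembert _ _ mk wj s0).
have kj : (k - j.+1).+1 = (k - j)%N by rewrite subnSK.
have E1 x : 0 < x -> hder (k - j) 0 (iter j dAlembert phi) p x =
    4 ^+ j * (x ^+ j * hder (k + j) 0 phi p x) by exact: IHj (ltnW jk) x.
have dR : is_derive s 1 (fun x => 4 ^+ j * (x ^+ j * hder (k + j) 0 phi p x))
    (4 ^+ j * (s ^+ j * hder (k + j).+1 0 phi p s + j%:R * s ^+ j.-1 * hder (k + j) 0 phi p s)).
  have dX : is_derive s 1 (fun x : R => x ^+ j) (j%:R * s ^+ j.-1).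
    apply: DeriveDef; first exact: exprn_derivable.
    by rewrite exp_derive [_ *: _]mulr1 -mulr_natl.
  have dM := is_deriveM dX (is_derive_hder (k + j) 0 p ws s0).
  have ab (a1 b1 : R) : a1 *: (b1 : R^o) = a1 * b1 by [].
  have := is_deriveZ (4 ^+ j : R) dM.
  by move=> H; apply: is_derive_eq H _; rewrite !ab; ring.
have E2 := is_derive_unique_pos s0 E1 (is_derive_hder (k - j) 0 p wj s0) dR.
rewrite kj E2 E1// addnS.
(* The coefficient [-j] cancels the term [j s^(j-1)] of the product rule. This cancellation is why
   the order of the derivative on the left is [k - j], decreasing with each application of the
   d'Alembertian. *)
have -> : (k - j.+1)%:R + 1 - k%:R = - j%:R :> R.
  by rewrite natr1 kj natrB ?(ltnW jk)//; ring.
(* At [j = 0] the truncated exponent [j.-1] is harmless, since its coefficient vanishes. *)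
case: j {IHj jk kj wj E1 dR E2} => [|j]; first by rewrite mul0r; ring.
by rewrite /= !exprS; ring.
Qed.

End WaveIdentity.

Lemma Rintegral_dominated_cvg d (Y : measurableType d) (R : realType)
    (mu : {measure set Y -> \bar R}) (F : nat -> Y -> R) (f g : Y -> R) :
    (forall n, measurable_fun setT (F n)) -> measurable_fun setT f ->
    (forall y, F n y @[n --> \oo] --> f y) ->
    mu.-integrable setT (EFin \o g) -> (forall n y, `|F n y| <= g y) ->
  \int[mu]_y F n y @[n --> \oo] --> \int[mu]_y f y.
Proof.
move=> mF mf Ff ig Fg.
have [|||||_ _ H] := @dominated_convergence _ _ _ mu setT measurableT
  (fun n => EFin \o F n) (EFin \o f) (EFin \o g).
- by move=> n; apply/measurable_EFinP; exact: mF.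
- exact/measurable_EFinP.
- by apply: aeW => y _; apply: cvg_EFin; [exact: nearW|exact: Ff].
- exact: ig.
- by apply: aeW => y n _; rewrite lee_fin.
- have If : mu.-integrable setT (EFin \o f).
    apply: le_integrable ig => //; first exact/measurable_EFinP.
    move=> y _ /=; rewrite lee_fin (ger0_norm (x := g y)).
      by apply: (cvgr_to_le (cvg_norm (Ff y))); exact: nearW.
    by apply: le_trans (Fg 0%N y).
  by apply: fine_cvg; rewrite fineK; [exact: H|exact: integrable_fin_num].
Qed.

Lemma cvg_lincomb (R : realType) (u v : nat -> R) (a b x y : R) :
    u n @[n --> \oo] --> x -> v n @[n --> \oo] --> y ->
  (a * u n - b * v n) @[n --> \oo] --> a * x - b * y.
Proof. by move=> ux vy; apply: cvgB; exact: cvgMl_tmp. Qed.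

(** * The limit at the vertex *)

Section VertexLimit.
Context {R : realType} {m : nat}.
Local Notation T := (measurableTypeR R).
Local Notation V := (spacetime R m).
Local Notation lambda := (lebesgue_tuple m).
Implicit Types (f psi phi : V -> R) (p q : V) (v : 'rV[R]_m) (s e : R).

(** The forward cone at [p] contains the hyperboloids of every [s >= 0] and all their dilates, so
    one bound serves along the whole limit. *)
Lemma past_bound t0 f p : continuous f -> past t0 f ->
  exists2 M, 0 <= M & forall q, `|q.1| <= q.2 -> `|f (p + q)| <= M.
Proof.
move=> cf pf; pose b := Num.max 0 (t0 - p.2).
have b0 : 0 <= b by rewrite le_max lexx.
have [M MP] := bounded_on_box (`|p| + b) cf.
have M0 : 0 <= M by apply: le_trans (MP 0 _ _); rewrite ?normr0 ?addr_ge0.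
exists M => // q q12; have [h|h] := leP q.2 b.
  have : `|p| <= `|p| by [].
  rewrite {1}prod_norm_le => /andP[p1 p2].
  apply: MP; apply: (le_trans (ler_normD _ _)); apply: lerD => //.
    exact: le_trans q12 h.
  by rewrite ger0_norm// (le_trans _ q12).
rewrite pf ?normr0//=; move: h; rewrite gt_max => /andP[_].
by rewrite ltrBlDl.
Qed.

Lemma hrad_scale e v : 0 < e -> hrad (e ^+ 2) (e *: v) = e * hrad 1 v.
Proof.
move=> e0; rewrite -[e in RHS](ger0_norm (ltW e0)) -sqrtr_sqr /hrad -sqrtrM ?sqr_ge0//.
congr Num.sqrt; rewrite mulrDr mulr1 mulr_sumr; congr (_ + _).
by apply: eq_bigr => i _; rewrite mxE exprMn.
Qed.

(* [hint l psi p (e ^+ 2)] after the substitution [v = e w], up to a power of [e]. *)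
Definition scaled_hint l psi p e : R :=
  \int[lambda]_u (radw l 1 u * psi (p + e *: hyperboloid 1 u)).

Lemma dilate_continuous f p e : continuous f -> continuous (fun q => f (p + e *: q)).
Proof.
move=> cf q; apply: (@cvg_comp _ _ _ (fun q => p + e *: q) f); last exact: cf.
by apply: cvgD; [exact: cvg_cst|apply: cvgZ; [exact: cvg_cst|exact: cvg_id]].
Qed.

Lemma scaled_measurable l f p e : continuous f ->
  measurable_fun setT (fun u => radw l 1 u * f (p + e *: hyperboloid 1 u)).
Proof.
move=> cf; apply: measurable_funM; first exact: measurable_radw.
apply: (@measurable_hyperboloid _ _ 1 (fun q => f (p + e *: q))).
exact: dilate_continuous.
Qed.

Lemma scaled_integrable l t0 f p e : 0 < e -> continuous f -> past t0 f ->
  lambda.-integrable setT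
    (EFin \o (fun u => radw l 1 u * f (p + e *: hyperboloid 1 u))).
Proof.
move=> e0 cf pf.
have pf' : past ((t0 - p.2) / e) (fun q => f (p + e *: q)).
  move=> q; rewrite ltr_pdivrMr// => qt; apply: pf => /=.
  by rewrite -ltrBlDl; change (t0 - p.2 < e * q.2); rewrite mulrC.
have := superpose_integrable (measurable_hyperboloid 1) (hyperboloid_proper ler01)
  (measurable_radw l ltr01) (fun u => radw_le l u ltr01) 0 (dilate_continuous (p := p) (e := e) cf) pf'.
by under eq_fun do rewrite add0r.
Qed.

(** Dilation by [e] carries the unit hyperboloid to the one with [s = e^2]: the volume element gives
    [e^m], the weight gives [e^-l]. *)
Lemma hint_scale l t0 psi p e : 0 < e -> continuous psi -> past t0 psi ->
  e ^+ l * hint l psi p (e ^+ 2) = e ^+ m * scaled_hint l psi p e.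
Proof.
move=> e0 cf pf; have e20 : 0 < e ^+ 2 by rewrite exprn_gt0.
pose G v := (hrad (e ^+ 2) v)^-1 ^+ l * psi (p + (v, hrad (e ^+ 2) v)).
have IG : lambda.-integrable setT (fun u => (G (row_of_tuple u))%:E).
  have := superpose_integrable (measurable_hyperboloid (e ^+ 2))
    (hyperboloid_proper (ltW e20)) (measurable_radw l e20)
    (fun u => radw_le l u e20) p cf pf.
  exact.
have := Rintegral_row_affine 0 e0 IG.
have -> : \int[lambda]_u G (e *: row_of_tuple u + 0) =
    (e^-1) ^+ l * scaled_hint l psi p e.
  rewrite /scaled_hint -RintegralZl//; last exact: scaled_integrable cf pf.
  apply: eq_Rintegral => u _; rewrite addr0 /G hrad_scale// invfM exprMn -mulrA.
  by rewrite /radw /hyperboloid.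
have -> : \int[lambda]_u G (row_of_tuple u) = hint l psi p (e ^+ 2) by [].
move=> H; have el : e ^+ l != 0 by rewrite expf_neq0// gt_eqF.
have em : e ^+ m != 0 by rewrite expf_neq0// gt_eqF.
apply: (mulfI (invr_neq0 el)); apply: (mulfI (invr_neq0 em)).
rewrite mulKf// [in RHS]mulrCA mulKf// -!exprVn.
exact: esym.
Qed.

Lemma oneDsqrV_ge0 (x : R) : 0 <= (oneDsqr x)^-1.
Proof. by rewrite invr_ge0 (le_trans ler01)// oneDsqr_ge1. Qed.

(** [(1 + |v|^2)^m] is at least the product of the [m] factors [1 + v_i^2], each being at most
    [1 + |v|^2]; larger [l] only helps, as the radius is at least 1. *)
Lemma radw_dominated l (u : m.-tuple T) : (2 * m <= l)%N ->
  radw l 1 u <= \prod_(i < m) (oneDsqr (tnth u i))^-1.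
Proof.
move=> ml; set v := row_of_tuple u.
have r1 : 1 <= hrad 1 v.
  by rewrite -[leLHS]sqrtr1 ler_wsqrtr// lerDr sqnorm_ge0.
have r0 : 0 < hrad 1 v by exact: lt_le_trans r1.
apply: (@le_trans _ _ (radw (2 * m) 1 u)).
  by rewrite /radw ler_wiXn2l ?invr_ge0 ?hrad_ge0// invf_le1.
rewrite /radw -/v exprM exprVn sqr_hrad// -[X in _ ^+ X]card_ord -prodr_const.
apply: ler_prod => i _; rewrite invr_ge0 addr_ge0 ?sqnorm_ge0//=.
have o0 : 0 < oneDsqr (tnth u i) by exact: lt_le_trans ltr01 (oneDsqr_ge1 _).
have s0 : 0 < \sum_(j < m) v 0 j ^+ 2 + 1 by rewrite ltr_wpDl ?sqnorm_ge0.
rewrite lef_pV2 ?posrE//.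
rewrite /oneDsqr addrC lerD2r (bigD1 i)//= mxE lerDl.
by apply: sumr_ge0 => j _; exact: sqr_ge0.
Qed.

Lemma radw_ge0 l s (u : m.-tuple T) : 0 <= radw l s u.
Proof. by rewrite exprn_ge0// invr_ge0 hrad_ge0. Qed.

Lemma norm_dilate e (u : m.-tuple T) : 0 <= e ->
  `|(e *: hyperboloid 1 u : V).1| <= (e *: hyperboloid 1 u : V).2.
Proof.
by move=> e0; rewrite normrZ ger0_norm//= ler_wpM2l//; exact: norm_le_hrad.
Qed.

Lemma scaled_hint_cvg l t0 psi p : (2 * m <= l)%N -> wave_source t0 psi ->
  scaled_hint l psi p (harmonic n) @[n --> \oo] -->
  \int[lambda]_u radw l 1 u * psi p.
Proof.
move=> ml [sf pf]; have cf := smooth_continuous sf.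
have [M M0 MP] := past_bound p cf pf.
have IP := integrable_prod_oneDsqrV (R := R) m.
rewrite -RintegralZr//; last first.
  apply: le_integrable IP => //.
    by apply/measurable_EFinP; exact: measurable_radw.
  move=> u _ /=; rewrite lee_fin !ger0_norm ?radw_ge0 ?radw_dominated//.
  by apply: prodr_ge0 => i _; exact: oneDsqrV_ge0.
apply: (@Rintegral_dominated_cvg _ _ _ lambda _ _
  (fun u => (\prod_(i < m) (oneDsqr (tnth u i))^-1) * M)).
- by move=> n; exact: scaled_measurable.
- by apply: measurable_funM => //; exact: measurable_radw.
- move=> u; apply: cvgM; first exact: cvg_cst.
  apply: (@cvg_comp _ _ _ (fun n => p + harmonic n *: hyperboloid 1 u) psi (nbhs \oo) (nbhs p)).
    have : p + (harmonic n : R) *: hyperboloid 1 u @[n --> \oo] --> p + (0 : R) *: hyperboloid 1 u.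
      apply: cvgD; first exact: cvg_cst.
      by apply: cvgZ; [exact: cvg_harmonic|exact: cvg_cst].
    by rewrite scale0r addr0.
  exact: cf.
- have := integrableZr measurableT M IP.
  by congr (lambda.-integrable _ _).
- move=> n u; rewrite normrM ler_pM//.
    by rewrite ger0_norm ?radw_ge0// radw_dominated.
  by apply: MP; apply: norm_dilate; rewrite ltW// harmonic_gt0.
Qed.

Lemma hint_vertex0 l t0 psi p : (l <= 2 * m)%N -> wave_source t0 psi ->
  harmonic n ^+ m.+1 * hint l psi p (harmonic n ^+ 2) @[n --> \oo] --> 0.
Proof.
move=> lm [sf pf]; have cf := smooth_continuous sf.
(* For small [l] the weight [r^-l] alone need not be integrable at infinity. On the dilated
   hyperboloid [q.2 - p.2 = e r], so trading [psi] for [chi] raises the weight to the integrable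
   [r^-(2m)] at the cost of [e^-(2m-l)]. One factor [e] is left over, and it forces the limit 0. *)
pose chi q := (q.2 - p.2) ^+ (2 * m - l) * psi q.
have cchi : continuous chi.
  apply: continuous_mul => // q.
  apply: (@continuous_comp _ _ _ (fun q : V => q.2 - p.2) (fun x : R => x ^+ (2 * m - l))).
    by apply: cvgB; [exact: cvg_snd|exact: cvg_cst].
  exact: exprn_continuous.
have pchi : past t0 chi by move=> q qt; rewrite /chi pf// mulr0.
have [M M0 MP] := past_bound p cchi pchi.
have IP := integrable_prod_oneDsqrV (R := R) m.
pose c := \int[lambda]_u (\prod_(i < m) (oneDsqr (tnth u i))^-1) * M.
have E n : harmonic n ^+ m.+1 * hint l psi p (harmonic n ^+ 2) =
    harmonic n * scaled_hint (2 * m) chi p (harmonic n).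
  have e0 : 0 < harmonic n :> R by rewrite harmonic_gt0.
  move: (harmonic n : R) e0 => e e0.
  have el : e ^+ l != 0 by rewrite expf_neq0// gt_eqF.
  apply: (mulfI el); rewrite mulrCA (hint_scale l p e0 cf pf).
  have -> : scaled_hint (2 * m) chi p e = e ^+ (2 * m - l) * scaled_hint l psi p e.
    rewrite /scaled_hint -RintegralZl//; last exact: scaled_integrable cf pf.
    apply: eq_Rintegral => u _; rewrite /chi /radw /= addrAC subrr add0r.
    set r := hrad 1 _; have r0 : r != 0 by rewrite gt_eqF// hrad_gt0.
    rewrite [e *: r]/(e * r) exprMn -(subnK lm) exprD addnK.
    by rewrite exprVn; field; rewrite !expf_neq0.
  move: (scaled_hint _ _ _ _) => S; rewrite !mulrA -exprSr -!exprD.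
  by congr (_ * _); congr (_ ^+ _); lia.
have bnd n : `|harmonic n ^+ m.+1 * hint l psi p (harmonic n ^+ 2)| <= harmonic n * c.
  have e0 : 0 < harmonic n :> R by rewrite harmonic_gt0.
  rewrite E normrM ger0_norm ?(ltW e0)// ler_pM2l//.
  have IS := scaled_integrable (2 * m) p e0 cchi pchi.
  apply: (le_trans (le_normr_Rintegral measurableT IS)).
  rewrite /c -RintegralZr//; apply: le_Rintegral => //.
  - exact: integrable_norm.
  - by have := integrableZr measurableT M IP; congr (lambda.-integrable _ _).
  - move=> u _; rewrite normrM ler_pM//.
      by rewrite ger0_norm ?radw_ge0// radw_dominated.
    by apply: MP; apply: norm_dilate; exact: ltW.
have hc : (harmonic n * c : R) @[n --> \oo] --> (0 : R).
  by rewrite -(mul0r c); apply: cvgM; [exact: cvg_harmonic|exact: cvg_cst].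
apply: norm_cvg0; apply: (@squeeze_cvgr _ _ _ _ (cst 0) _ _ _ _ _ hc).
- by apply: nearW => n /=; rewrite normr_ge0 bnd.
- exact: cvg_cst.
Qed.

Definition kappa : R := \int[lambda]_u radw (2 * m).+1 1 u.

(** The critical exponent: [e^(m+1)] times [e^(m - (2m+1))] is 1, and the rescaled integral
    converges by domination. *)
Lemma hint_vertex t0 psi p : wave_source t0 psi ->
  harmonic n ^+ m.+1 * hint (2 * m).+1 psi p (harmonic n ^+ 2) @[n --> \oo] -->
  kappa * psi p.
Proof.
move=> ws; have := scaled_hint_cvg (p := p) (leqnSn (2 * m)) ws; apply: cvg_trans.
apply: near_eq_cvg; apply: nearW => n /=.
have : 0 < n.+1%:R^-1 :> R by rewrite invr_gt0.
move: (n.+1%:R^-1 : R) => e e0.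
have em : e ^+ m != 0 by rewrite expf_neq0// gt_eqF.
apply: (mulfI em); rewrite -(hint_scale _ p e0 (smooth_continuous ws.1) ws.2).
by rewrite mulrA -exprD addnS mul2n addnn.
Qed.

(** Coefficient of the term of [hder n l] in which all [n] derivatives fall on the weight: the
    product of [-(l + 2i)/2] over [i < n]. *)
Fixpoint radial_const n l : R :=
  if n is n'.+1 then - (l%:R / 2) * radial_const n' l.+2 else 1.

Lemma radial_const_neq0 n l : odd l -> radial_const n l != 0.
Proof.
elim: n l => [|n IHn] l ol /=; first exact: oner_neq0.
rewrite mulf_neq0 ?IHn//=; last by rewrite negbK.
by rewrite oppr_eq0 mulf_neq0 ?invr_neq0// pnatr_eq0; case: l ol.
Qed.

(* With [s = e ^+ 2] as [e] tends to 0, only the terms of [hder] in which no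
   derivative falls on [psi] are singular enough to survive. *)
Lemma hder_vertex0 n l t0 psi p : (2 * n + l <= 2 * m)%N -> wave_source t0 psi ->
  harmonic j ^+ m.+1 * hder n l psi p (harmonic j ^+ 2) @[j --> \oo] --> 0.
Proof.
elim: n l psi => [|n IHn] l psi; first by rewrite muln0 add0n; exact: hint_vertex0.
rewrite mulnS => nl ws.
have L1 : (2 * n + l.+1 <= 2 * m)%N by apply: leq_trans nl; lia.
have L2 : (2 * n + l.+2 <= 2 * m)%N by apply: leq_trans nl; lia.
have c1 := IHn _ _ L1 (wave_source_pderive None ws).
have c2 := IHn _ _ L2 ws.
have := cvg_lincomb (a := 2^-1) (b := l%:R / 2) c1 c2.
rewrite !mulr0 subr0; apply: cvg_trans; apply: near_eq_cvg; apply: nearW => j /=.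
by rewrite mulrBr; congr (_ - _); rewrite mulrCA.
Qed.

Lemma hder_vertex n l t0 psi p : (2 * n + l = (2 * m).+1)%N -> wave_source t0 psi ->
  harmonic j ^+ m.+1 * hder n l psi p (harmonic j ^+ 2) @[j --> \oo] -->
  radial_const n l * (kappa * psi p).
Proof.
elim: n l psi => [|n IHn] l psi.
  by rewrite muln0 add0n => -> ws; rewrite mul1r; exact: hint_vertex ws.
rewrite mulnS => nl ws.
have L1 : (2 * n + l.+1 <= 2 * m)%N by lia.
have L2 : (2 * n + l.+2 = (2 * m).+1)%N by rewrite -nl; lia.
have c1 := hder_vertex0 p L1 (wave_source_pderive None ws).
have c2 := IHn _ _ L2 ws.
have := cvg_lincomb (a := 2^-1) (b := l%:R / 2) c1 c2.
have -> : radial_const n.+1 l * (kappa * psi p) =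
    2^-1 * 0 - l%:R / 2 * (radial_const n l.+2 * (kappa * psi p)).
  by rewrite /= mulr0 sub0r !mulNr !mulrA.
apply: cvg_trans; apply: near_eq_cvg; apply: nearW => j /=.
by rewrite mulrBr; congr (_ - _); rewrite mulrCA.
Qed.

(* The integral [kappa] converges, and is not the junk value 0 of a divergent one,
   because its integrand is integrable ([IK] below). *)
Lemma kappa_gt0 : 0 < kappa.
Proof.
have IK : lambda.-integrable setT (EFin \o (fun u : m.-tuple T => radw (2 * m).+1 (1 : R) u)).
  apply: le_integrable (integrable_prod_oneDsqrV m) => //.
    by apply/measurable_EFinP; exact: measurable_radw.
  move=> u _ /=; rewrite lee_fin !ger0_norm ?radw_ge0 ?radw_dominated//.
  by apply: prodr_ge0 => i _; exact: oneDsqrV_ge0.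
(* A lower bound of the weight on the unit box, where [|v|^2 <= m]. *)
pose b := (Num.sqrt (m%:R + 1) : R)^-1 ^+ (2 * m).+1.
have b0 : 0 < b by rewrite exprn_gt0// invr_gt0 sqrtr_gt0 ltr_wpDl.
pose G := (fun _ : m.-tuple T => b) \_ (box 1).
have boxE2 : lambda (box (1 : R)) = (2 ^+ m)%:E.
  rewrite boxE// (lebesgue_tuple_box (A := fun=> `[- (1 : R), 1]%classic)); last first.
    by move=> i; exact: measurable_itv.
  rewrite (eq_bigr (fun=> (2 : R)%:E)); last first.
    move=> i _; rewrite lebesgue_measure_itv/= lte_fin ifT; last by lra.
    by rewrite -EFinB opprK.
  by rewrite prodEFin prodr_const card_ord.
apply: (@lt_le_trans _ _ (\int[lambda]_u G u)).
  rewrite /G -Rintegral_mkcond Rintegral_cst; last exact: measurable_box.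
  suff : 0 < fine (lambda (box (1 : R))) by exact: mulr_gt0.
  by rewrite boxE2 /= exprn_gt0.
apply: le_Rintegral => //.
  apply: (integrable_bounded (measurable_box 1) (lebesgue_box_lty m 1) _ (M := b)) => [|u|u ub].
  - by apply/(measurable_restrictT _ (measurable_box 1)); exact: measurable_cst.
  - by rewrite /G patchE; case: ifP => _; rewrite ?normr0 ?ger0_norm// ltW.
  - by rewrite /G patchE memNset.
move=> u _; rewrite /G patchE; case: ifPn => [|_]; last exact: radw_ge0.
rewrite inE /box /= => u1; rewrite /b /radw.
apply: lerXn2r; rewrite ?nnegrE ?invr_ge0 ?sqrtr_ge0 ?hrad_ge0//.
rewrite lef_pV2 ?posrE ?hrad_gt0 ?sqrtr_gt0 ?ltr_wpDl//.
rewrite ler_wsqrtr// lerD2r -[m in m%:R]card_ord -sum1_card natr_sum ler_sum// => i _.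
have := (rV_norm_le _ ler01).1 u1 i; rewrite -real_normK ?num_real// => ui.
by rewrite exprn_ile1.
Qed.

Lemma hint_cone t0 psi p : wave_source t0 psi ->
  hint 0 psi p (harmonic n ^+ 2) @[n --> \oo] --> conical_radon psi p.
Proof.
move=> [sf pf]; have cf := smooth_continuous sf.
have [M M0 MP] := past_bound p cf pf.
pose b := t0 - p.2.
have -> : conical_radon psi p = \int[lambda]_u psi (p + hyperboloid 0 u).
  by apply: eq_Rintegral => u _; rewrite /hyperboloid /hrad addr0.
have sn n : 0 <= (harmonic n : R) ^+ 2 by exact: sqr_ge0.
(* All the hyperboloids lie above the cone, so outside [box b] their points are later than [t0] and
   a constant on the box dominates. *)
apply: (@Rintegral_dominated_cvg _ _ _ lambda _ _ ((fun _ => M) \_ (box b))).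
- by move=> n; apply: superpose_measurable;
    [exact: measurable_hyperboloid|apply: measurable_radw; rewrite exprn_gt0// harmonic_gt0|].
- apply: (@measurable_hyperboloid _ _ 0 (fun q => psi (p + q))).
  exact: translate_continuous.
- move=> u; rewrite /radw; under eq_fun do rewrite expr0 mul1r.
  have hc : hrad (harmonic n ^+ 2) (row_of_tuple u) @[n --> \oo] --> hrad 0 (row_of_tuple u).
    apply: (@cvg_comp _ _ _ (fun n => \sum_(i < m) (row_of_tuple u) 0 i ^+ 2 + harmonic n ^+ 2)
      (@Num.sqrt R)); last exact: sqrt_continuous.
    apply: cvgD; first exact: cvg_cst.
    have : (harmonic n * harmonic n : R) @[n --> \oo] --> (0 * 0 : R).
      by apply: cvgM; exact: cvg_harmonic.
    by rewrite mulr0.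
  apply: (@cvg_comp _ _ _ (fun n => p + hyperboloid (harmonic n ^+ 2) u) psi); last exact: cf.
  apply: cvgD; first exact: cvg_cst.
  have k1 : row_of_tuple u @[_ --> \oo] --> row_of_tuple u by exact: cvg_cst.
  exact: (cvg_pair k1 hc).
- apply: (integrable_bounded (measurable_box b) (lebesgue_box_lty m b) _ (M := M)) => [|u|u ub].
  - by apply/(measurable_restrictT _ (measurable_box b)); exact: measurable_cst.
  - by rewrite patchE; case: ifP => _; rewrite ?normr0// ger0_norm.
  - by rewrite patchE memNset.
- move=> n u; rewrite /radw expr0 mul1r patchE; case: ifPn => [_|].
    by apply: MP => /=; exact: norm_le_hrad.
  rewrite notin_setE /box /= => /negP; rewrite -ltNge => ub.
  rewrite pf ?normr0//= -ltrBlDl; apply: lt_le_trans ub _; exact: norm_le_hrad.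
Qed.

(** The factor [4^k] comes from the [k] d'Alembertians, [1/2] from the first [s]-derivative, which
    sees no weight, and [radial_const m 1] from the other [m] derivatives, all falling on the weight
    [r^-1]. *)
Definition cone_const k : R := 4 ^+ k * (2^-1 * (radial_const m 1 * kappa)).

Lemma cone_const_neq0 k : cone_const k != 0.
Proof.
rewrite !mulf_neq0 ?expf_neq0 ?invr_neq0 ?radial_const_neq0//.
by rewrite gt_eqF// kappa_gt0.
Qed.

Theorem conical_radon_iter_dAlembert t0 k phi p : m.+1 = (2 * k)%N ->
    wave_source t0 phi ->
  conical_radon (iter k dAlembert phi) p = cone_const k * pderive None phi p.
Proof.
move=> mk ws; have wk := wave_source_iter_dAlembert k ws.
have L1 := hint_cone (p := p) wk.
have mm : (2 * m + 1 = (2 * m).+1)%N by rewrite addn1.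
have L2 := hder_vertex (p := p) mm (wave_source_pderive None ws).
have {}L2 : hint 0 (iter k dAlembert phi) p (harmonic n ^+ 2) @[n --> \oo] -->
    4 ^+ k * (2^-1 * (radial_const m 1 * (kappa * pderive None phi p))).
  have := @cvgMl_tmp _ _ _ _ _ (4 ^+ k) _ (@cvgMl_tmp _ _ _ _ _ (2^-1) _ L2) => /(_ _ _).
  apply: cvg_trans; apply: near_eq_cvg; apply: nearW => n /=.
  have s0 : 0 < (harmonic n : R) ^+ 2 by rewrite exprn_gt0// harmonic_gt0.
  have := hder_iter_dAlembert p mk (leqnn k) ws s0; rewrite subnn /= => ->.
  (* Here [k + k = m + 1]: one derivative is unfolded at [l = 0], where its weight term vanishes,
     and [s^k] becomes [e^(m+1)]. *)
  rewrite addnn -mul2n -mk /= mul0r mul0r subr0 -exprM -mk.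
  by congr (_ * _); rewrite mulrCA.
have := cvg_unique _ L1 L2; rewrite /cone_const => ->; last exact: norm_hausdorff.
by rewrite !mulrA.
Qed.

End VertexLimit.

(** * The range of the conical Radon transform *)

Section Supports.
Context {R : realType} {m : nat}.
Local Notation V := (spacetime R m).
Implicit Types (f : V -> R) (p : V).

Lemma notin_supp f p : ~ supp f p -> f p = 0.
Proof.
by move=> h; apply/eqP/negPn/negP => fp; apply: h; exact: subset_closure.
Qed.

Lemma compact_suppP f : compact (supp f) <->
  exists2 rho, 0 < rho & forall p, rho < `|p| -> f p = 0.
Proof.
split=> [/compact_bounded[M [_ MP]]|[rho _ rhoP]].
  have M1 : M < `|M| + 1 by rewrite (le_lt_trans (ler_norm M))// ltrDl.
  exists (`|M| + 1) => [|p]; first by rewrite ltr_wpDl.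
  rewrite ltNge => /negP pM; apply: notin_supp => fp; apply: pM.
  exact: (MP (`|M| + 1)).
pose K : set V := [set z | `|z| <= rho].
have cK : compact K by exact: compact_norm_le.
apply: (subclosed_compact (@closed_closure _ _) cK).
have clK : closed K by apply: compact_closed cK; exact: norm_hausdorff.
rewrite (closure_id K).1//; apply: closureS => p /= /eqP fp.
by rewrite /K /= leNgt; apply/negP => /rhoP.
Qed.

Lemma supp_halfspaceP f t0 : supp f `<=` halfspace t0 <-> past t0 f.
Proof.
split=> [h p tp|pf].
  by apply: notin_supp => /h; rewrite /halfspace /= leNgt tp.
have clH : closed (halfspace t0 : set V).
  have -> : halfspace t0 = ~` [set p : V | t0 < p.2].
    apply/seteqP; split=> p; rewrite /halfspace /=; first by move=> h; apply/negP; rewrite -leNgt.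
    by move/negP; rewrite -leNgt.
  apply: open_closedC.
  by apply: open_comp (@open_gt R t0) => q _; exact: cvg_snd.
rewrite (closure_id (halfspace t0)).1//; apply: closureS => p /= /eqP fp.
by rewrite /halfspace /= leNgt; apply/negP => /pf.
Qed.

Lemma test_function_wave_source f : test_function f -> exists t0, wave_source t0 f.
Proof.
move=> [sf /compact_suppP[rho _ rhoP]]; exists rho; split => // p tp; apply: rhoP.
rewrite ltNge prod_norm_le; apply/negP => /andP[_ /(le_trans (ler_norm _))].
by rewrite leNgt tp.
Qed.

End Supports.

(** * Integration along lines parallel to the time axis *)

Section TimeIntegral.
Context {R : realType} {m : nat}.
Local Notation T := (measurableTypeR R).
Local Notation V := (spacetime R m).
Local Notation mu := (@lebesgue_measure R).
Implicit Types (f g : V -> R) (p q : V).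

Lemma continuous_time_line f p : continuous f -> continuous (fun y : R => f (p + (0, y))).
Proof.
move=> /translate_continuous cf y.
apply: (@cvg_comp _ _ _ (fun y : R => (0, y)) (fun q => f (p + q))); last exact: cf.
have k0 : (0 : 'rV[R]_m) @[_ --> y] --> (0 : 'rV[R]_m) by exact: cvg_cst.
exact: (cvg_pair k0 (@cvg_id _ (nbhs y))).
Qed.

Lemma Rintegral_pderive_time f p (a b : R) : smooth f -> a < b ->
  \int[mu]_(y in `[a, b]) pderive None f (p + (0, y)) =
  f (p + (0, b)) - f (p + (0, a)).
Proof.
move=> sf ab.
pose F (y : R) := f (p + y *: coord_dir None).
have E (y : R) : p + (0, y) = p + y *: coord_dir None :> V.
  by congr (_ + _); congr pair; rewrite /= ?scaler0// [RHS]mulr1.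
have dF (y : R) : is_derive y 1 F (pderive None f (p + (0, y))).
  by rewrite E; apply: is_derive_lineT; exact: smooth_derivable.
have cF : continuous F.
  by move=> y; apply/differentiable_continuous/derivable1_diffP; case: (dF y).
have -> : f (p + (0, b)) - f (p + (0, a)) = F b - F a by rewrite /F !E.
rewrite /Rintegral (@continuous_FTC2 _ _ F) //.
- apply: continuous_subspaceT; exact/continuous_time_line/smooth_continuous/smooth_pderive.
- split; [by move=> y _; case: (dF y)|exact/cvg_at_right_filter/cF|exact/cvg_at_left_filter/cF].
- by move=> y _; rewrite derive1E; case: (dF y).
Qed.

Lemma Rintegral_vanish (h : R -> R) (a b : R) :
  (forall y, ~ `[a, b]%classic y -> h y = 0) ->
  \int[mu]_y h y = \int[mu]_(y in `[a, b]) h y.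
Proof.
move=> h0; rewrite [RHS]Rintegral_mkcond; apply: eq_Rintegral => y _.
by rewrite patchE; case: ifPn => //; rewrite notin_setE => /h0.
Qed.

Lemma pderive_vanish f c rho : (forall p, rho < `|p| -> f p = 0) ->
  forall p, rho < `|p| -> pderive c f p = 0.
Proof.
move=> f0 p rp.
rewrite /pderive -(derive_cst (0 : R^o) p (coord_dir c)); apply: near_eq_derive.
have : open [set q : V | rho < `|q|].
  by apply: open_comp (@open_gt R rho) => q _; exact: norm_continuous.
by rewrite openE => /(_ _ rp); apply: filterS => q; exact: f0.
Qed.

Lemma time_norm_le p : `|p.2| <= `|p|.
Proof. by have : `|p| <= `|p| by []; rewrite {1}prod_norm_le => /andP[]. Qed.

Lemma space_norm_le p : `|p.1| <= `|p|.
Proof. by have : `|p| <= `|p| by []; rewrite {1}prod_norm_le => /andP[]. Qed.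

Lemma notin_itvN (b y : R) : ~ `[- b, b]%classic y -> b < `|y|.
Proof. by rewrite /= in_itv/= -ler_norml => /negP; rewrite -ltNge. Qed.

Lemma Rintegral_time_pderive f x rho : 0 < rho ->
    smooth f -> (forall p, rho < `|p| -> f p = 0) ->
  \int[mu]_t pderive None f (x, t) = 0.
Proof.
(* Vanishing is known only strictly beyond [rho], so the endpoints are taken at [rho + 1]. *)
move=> rho0 sf f0; rewrite (@Rintegral_vanish _ (- (rho + 1)) (rho + 1)); last first.
  move=> y /notin_itvN yr; apply: (pderive_vanish None f0).
  by apply: lt_le_trans (time_norm_le _); apply: lt_trans yr; rewrite ltrDl.
have E (y : R) : (x, y) = (x, 0) + (0, y) :> V by congr pair; rewrite /= ?addr0 ?add0r.
under eq_Rintegral do rewrite E.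
rewrite Rintegral_pderive_time//; last by lra.
by rewrite -!E !f0 ?subrr//; apply: lt_le_trans (time_norm_le _);
  rewrite /= ?normrN ger0_norm; lra.
Qed.

Lemma pderive_scale c (a : R) f : smooth f ->
  pderive c (fun p => a * f p) = fun p => a * pderive c f p.
Proof.
move=> sf; apply/funext => p.
have fd : derivable f p (coord_dir c) by exact: smooth_derivable.
exact: (deriveZ a fd).
Qed.

Lemma smooth_scale (a : R) f : smooth f -> smooth (fun p => a * f p).
Proof.
move=> /(smooth_linear a smooth0).
by congr smooth; apply/funext => p; rewrite add0r.
Qed.

(* The integral of [f (x, t + y)] over [y >= 0]; [`|y|] keeps the shift proper. *)
Definition future f : V -> R :=
  superpose mu (fun y : T => (0, `|y|)) \1_`[0, +oo[ f.

Lemma future_measurable f : continuous f ->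
  measurable_fun setT (fun y : T => f (0, `|y|)).
Proof.
move=> cf; apply: continuous_measurable_fun => y.
apply: (@cvg_comp _ _ _ (fun y : R => (0, `|y|)) f); last exact: cf.
have k0 : (0 : 'rV[R]_m) @[_ --> y] --> (0 : 'rV[R]_m) by exact: cvg_cst.
exact: (cvg_pair k0 (@norm_continuous _ _ y)).
Qed.

Lemma future_proper (b : R) : exists (A : set T) (rho : R),
  [/\ measurable A, (mu A < +oo)%E & forall y : T, ((0, `|y|) : V).2 <= b ->
    [/\ A y, `|((0, `|y|) : V).1| <= rho & `|((0, `|y|) : V).2| <= rho]].
Proof.
exists `[- b, b]%classic, b; split; first exact: measurable_itv.
  by rewrite lebesgue_measure_itv; case: ifP => _; rewrite ?ltry.
move=> y /= yb; split; first by rewrite in_itv/= -ler_norml.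
  by rewrite normr0; exact: le_trans yb.
by rewrite normr_id.
Qed.

Lemma future_bound (y : T) : `|\1_`[0, +oo[ y : R| <= 1.
Proof. by rewrite indicE; case: (_ \in _); rewrite ?normr0 ?normr1. Qed.

Lemma measurable_future_indic : measurable_fun setT (\1_`[0, +oo[ : T -> R).
Proof. by apply: measurable_indic; exact: measurable_itv. Qed.

Lemma past_future t0 f : past t0 f -> past t0 (future f).
Proof.
move=> pf p tp; rewrite /future /superpose.
under eq_Rintegral do rewrite pf ?mulr0 ?(lt_le_trans tp)//= ?lerDl//.
by rewrite Rintegral_cst// mul0r.
Qed.

Lemma wave_source_future t0 f : wave_source t0 f -> wave_source t0 (future f).
Proof.
move=> wf; split; last exact: past_future wf.2.
exact: (smooth_superpose future_measurable future_proper measurable_future_indic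
  future_bound wf).
Qed.

Lemma pderive_future t0 f : wave_source t0 f ->
  pderive None (future f) = fun p => - f p.
Proof.
move=> wf; have [sf pf] := wf.
rewrite (pderive_superpose future_measurable future_proper measurable_future_indic
  future_bound _ wf).
apply/funext => p; rewrite /superpose.
(* Late enough for [f] to vanish at time [p.2 + b], and positive so that the interval is
   nondegenerate. *)
pose b := Num.max 1 (t0 - p.2 + 1).
have b1 : 1 <= b by rewrite le_max lexx.
have b2 : t0 < p.2 + b.
  by rewrite -ltrBlDl; apply: (@lt_le_trans _ _ (t0 - p.2 + 1)); rewrite ?ltrDl// le_max lexx orbT.
rewrite (@Rintegral_vanish _ 0 b); last first.
  move=> y; rewrite /= in_itv/= => /negP; rewrite negb_and -!ltNge => /orP[y0|yb].
    by rewrite indicE memNset ?mul0r//= in_itv/= andbT; apply/negP; rewrite -ltNge.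
  rewrite (past_pderive _ pf) ?mulr0//=; apply: (lt_trans b2); rewrite ltrD2l.
  by apply: lt_le_trans yb _; exact: ler_norm.
transitivity (\int[mu]_(y in `[0, b]) pderive None f (p + (0, y))).
  apply: eq_Rintegral => y; rewrite inE /= in_itv/= => /andP[y0 _].
  by rewrite indicE mem_set ?mul1r ?ger0_norm//= in_itv/= y0.
rewrite Rintegral_pderive_time//; last exact: lt_le_trans b1.
rewrite pf//= sub0r; congr (- f _).
by rewrite -[RHS]addr0.
Qed.

(** Three regions cover the exterior. If [|x| > rho] the time line misses the support; if [t > rho]
    the whole future half-line does; if [t < -rho] the half-line contains the full support on its
    line, and the vanishing time integral applies. *)
Lemma future_vanish t0 f rho : wave_source t0 f -> 0 < rho ->
    (forall p, rho < `|p| -> f p = 0) ->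
    (forall x, \int[mu]_t f (x, t) = 0) ->
  forall p, rho + 1 < `|p| -> future f p = 0.
Proof.
move=> wf rho0 f0 If p rp.
have zero (q : V) : (forall y : R, rho < `|q + (0, `|y|)|) -> future f q = 0.
  move=> qy; rewrite /future /superpose.
  by under eq_Rintegral do rewrite f0 ?mulr0//; rewrite Rintegral_cst// mul0r.
have late (q : V) : rho < q.2 -> future f q = 0.
  move=> qr; apply: zero => y; apply: lt_le_trans (time_norm_le _) => /=.
  by apply: lt_le_trans (ler_norm _); rewrite ltr_wpDr.
have [p1|p1] := ltP rho `|p.1|.
  by apply: zero => y; apply: lt_le_trans (space_norm_le _); rewrite /= addr0.
have [|p2] := ltP rho p.2; first exact: late.
have p2r : p.2 < - rho.
  have : rho + 1 < `|p.2|.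
    move: rp; rewrite !ltNge; apply: contra => p2'.
    by rewrite prod_norm_le p2' andbT (le_trans p1)// lerDl.
  by rewrite lter_normr => /orP[]; lra.
have E (y : R) : (p.1, 0) + (0, y) = (p.1, y) :> V by congr pair; rewrite /= ?addr0 ?add0r.
have wF := wave_source_future wf.
have ab : p.2 < rho + 1 by lra.
(* The negative of [future f] has time derivative [f]; between [p.2] and [rho + 1] only its value at
   [p] remains, the later endpoint being covered by [late]. *)
have := Rintegral_pderive_time (p.1, 0) (smooth_scale (-1) wF.1) ab.
rewrite !E (late (p.1, rho + 1)) /= ?ltrDl// mulr0 sub0r mulN1r opprK -surjective_pairing.
rewrite (pderive_scale _ _ wF.1) (pderive_future wf) => <-.
rewrite -[RHS](If p.1); apply/esym.
rewrite (@Rintegral_vanish (fun y => f (p.1, y)) p.2 (rho + 1)).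
  by apply: eq_Rintegral => y _; rewrite E mulN1r opprK.
move=> y; rewrite /= in_itv/= => /negP; rewrite negb_and -!ltNge => yp.
apply: f0; apply: lt_le_trans (time_norm_le _) => /=.
by rewrite lter_normr; apply/orP; case/orP: yp => yp; [right|left]; lra.
Qed.

End TimeIntegral.

Section Range.
Context {R : realType} {m : nat}.
Local Notation T := (measurableTypeR R).
Local Notation V := (spacetime R m).
Local Notation lambda := (lebesgue_tuple m).
Implicit Types (f g : V -> R) (p : V).

Lemma conical_radonE f :
  conical_radon f = superpose lambda (hyperboloid 0) (fun=> 1) f.
Proof.
apply/funext => p; apply: eq_Rintegral => u _.
by rewrite mul1r /hyperboloid /hrad addr0.
Qed.

Let cone_meas := @measurable_hyperboloid R m 0.
Let cone_proper := @hyperboloid_proper R m 0 (lexx 0).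
Let cone_bound (u : m.-tuple T) : `|1 : R| <= 1.
Proof. by rewrite normr1. Qed.
Let cone_weight : measurable_fun setT (fun _ : m.-tuple T => 1 : R).
Proof. exact: measurable_cst. Qed.

Lemma wave_source_conical_radon t0 f : wave_source t0 f -> wave_source t0 (conical_radon f).
Proof.
move=> wf; split.
  rewrite conical_radonE.
  exact: (smooth_superpose cone_meas cone_proper cone_weight cone_bound wf).
move=> p tp; rewrite conical_radonE /superpose.
under eq_Rintegral do rewrite mul1r wf.2 ?(lt_le_trans tp)//= ?lerDl ?hrad_ge0//.
by rewrite Rintegral_cst// mul0r.
Qed.

Lemma pderive_conical_radon t0 c f : wave_source t0 f ->
  pderive c (conical_radon f) = conical_radon (pderive c f).
Proof.
move=> wf; rewrite !conical_radonE.
exact: (pderive_superpose cone_meas cone_proper cone_weight cone_bound c wf).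
Qed.

Lemma iter_dAlembert_conical_radon t0 n f : wave_source t0 f ->
  iter n dAlembert (conical_radon f) = conical_radon (iter n dAlembert f).
Proof.
move=> wf; rewrite !conical_radonE.
exact: (superpose_iter_dAlembert cone_meas cone_proper cone_weight cone_bound n wf).
Qed.

Lemma conical_radonZ t0 a f p : wave_source t0 f ->
  conical_radon (fun q => a * f q) p = a * conical_radon f p.
Proof.
move=> [sf pf]; rewrite !conical_radonE /superpose -RintegralZl//.
  by apply: eq_Rintegral => u _; rewrite mulrCA.
exact: (superpose_integrable cone_meas cone_proper cone_weight cone_bound p
  (smooth_continuous sf) pf).
Qed.

(** Integrating the common time derivative from [p] up to a time at which both functions vanish
    recovers both values at [p]. *)
Lemma past_pderive_time_eq t0 f g : wave_source t0 f -> wave_source t0 g ->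
  pderive None f = pderive None g -> f = g.
Proof.
move=> [sf pf] [sg pg] fg; apply/funext => p; apply/eqP; rewrite -subr_eq0; apply/eqP.
pose b := Num.max 1 (t0 - p.2 + 1).
have b1 : 0 < b by apply: lt_le_trans ltr01 _; rewrite le_max lexx.
have b2 : t0 < p.2 + b.
  by rewrite -ltrBlDl; apply: (@lt_le_trans _ _ (t0 - p.2 + 1)); rewrite ?ltrDl// le_max lexx orbT.
have := Rintegral_pderive_time p sf b1; have := Rintegral_pderive_time p sg b1.
rewrite fg => ->; rewrite (pf (p + (0, b)))// (pg (p + (0, b)))// !sub0r => /oppr_inj.
have -> : p + (0, 0) = p by exact: addr0.
by move=> ->; rewrite subrr.
Qed.

Theorem conical_radon_range k g : m.+1 = (2 * k)%N -> smooth g ->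
  (exists f : V -> R, test_function f /\ g = conical_radon f)
  <->
  [/\ compact (supp (iter k dAlembert g)),
      forall x : 'rV[R]_m, \int[lebesgue_measure]_t iter k dAlembert g (x, t) = 0
    & exists t0 : R, supp g `<=` halfspace t0].
Proof.
move=> mk sg; pose c := cone_const (R := R) (m := m) k.
have c0 : c != 0 by exact: cone_const_neq0.
split=> [[f [tf ->]]|[/compact_suppP[rho rho0 h0] Ih [t0 /supp_halfspaceP pg]]].
  have [t0 wf] := test_function_wave_source tf.
  have [_ /compact_suppP[rho rho0 f0]] := tf.
  have E : iter k dAlembert (conical_radon f) = fun p => c * pderive None f p.
    apply/funext => p; rewrite (iter_dAlembert_conical_radon _ wf).
    exact: conical_radon_iter_dAlembert mk wf.
  have Ec : (fun p => c * pderive None f p) = pderive None (fun p => c * f p).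
    by rewrite pderive_scale//; exact: wf.1.
  have cf0 p : rho < `|p| -> c * f p = 0 by move=> /f0 ->; rewrite mulr0.
  rewrite E Ec; split.
  - by apply/compact_suppP; exists rho => //; exact: pderive_vanish.
  - by move=> x; have := Rintegral_time_pderive x rho0 (smooth_scale c wf.1) cf0; rewrite -Ec.
  - by exists t0; apply/supp_halfspaceP; case: (wave_source_conical_radon wf).
pose h := iter k dAlembert g.
have wg : wave_source t0 g by [].
have wh : wave_source t0 h by exact: wave_source_iter_dAlembert.
have wF := wave_source_future wh.
(* The sign compensates for [future], whose time derivative is [- h]. *)
pose f p := - c^-1 * future h p.
have wf : wave_source t0 f.
  by split; [exact: smooth_scale wF.1|move=> p tp; rewrite /f wF.2// mulr0].
exists f; split.
  split; first exact: wf.1.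
  apply/compact_suppP; exists (rho + 1) => [|p rp]; first by rewrite addr_gt0.
  by rewrite /f (future_vanish wh rho0 h0 Ih rp) mulr0.
apply: (past_pderive_time_eq wg (wave_source_conical_radon wf)).
rewrite (pderive_conical_radon None wf).
have -> : pderive None f = fun p => c^-1 * h p.
  rewrite (pderive_scale _ _ wF.1) (pderive_future wh).
  by apply/funext => p; rewrite mulrNN.
apply/funext => p; rewrite (conical_radonZ _ _ wh).
by rewrite (conical_radon_iter_dAlembert p mk wg) mulKf.
Qed.

End Range.

Theorem theorem1 (R : realType) (k : nat) (k_ge1 : (1 <= k)%N)
    (g : spacetime R (2 * k - 1) -> R) (g_smooth : smooth g) :
  (exists f : spacetime R (2 * k - 1) -> R,
     test_function f /\ g = conical_radon f)
  <->
  [/\ compact (supp (iter k dAlembert g)),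
      forall x : 'rV[R]_(2 * k - 1),
        \int[lebesgue_measure]_t iter k dAlembert g (x, t) = 0
    & exists t0 : R, supp g `<=` halfspace t0].
(* Since [k >= 1], the truncated subtraction in [2 * k - 1] is exact. *)
Proof. by apply: conical_radon_range => //; lia. Qed.
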